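(* Let $\alpha$ be a peak composition. Then the map $\Xi_\alpha:\mathrm{SPIT}(\alpha)\to\mathrm{SPIT}(\alpha)$ (constructed in the context) is well-defined, and for all $T\in\mathrm{SPIT}(\alpha)$, $$\mathrm{Des}(\mathrm{w}_{\rm c}(T))=\mathrm{Des}(\mathrm{w}_{\rm r}(\Xi_\alpha(T))).$$
   Context: A composition $\alpha=(\alpha_1,\dots,\alpha_k)$ of $n=|\alpha|$ is a finite list of positive integers with sum $n$; $\ell(\alpha)=k$. Its diagram $D(\alpha)$ is the left-justified array with $\alpha_i$ boxes in row $i$, rows numbered from bottom to top; box $(i,j)$ lies in column $i$ and row $j$, and $T_{i,j}$ is the entry of a filling $T$ there. $c_i(\alpha)$ is the number of boxes in column $i$ of $D(\alpha)$. A peak composition is a composition all of whose parts, except possibly the last, are greater than $1$. A standard immaculate tableau (SIT) of shape $\alpha$ is a filling of $D(\alpha)$ with the numbers $1,\dots,n$, each used once, whose rows increase from left to right and whose first column increases from bottom to top. For a peak composition $\alpha$ of $n$, a standard peak immaculate tableau (SPIT) of shape $\alpha$ is an SIT of shape $\alpha$ such that for every $1\le k\le n$ the boxes with entries $\le k$ form the diagram of a peak composition. $\mathrm{SPIT}(\alpha)$ is the set of these. A generalized SPIT of shape $\alpha$ is a filling of $D(\alpha)$ with distinct positive integers $a_1<\cdots<a_{|\alpha|}$ such that replacing each $a_i$ by $i$ gives an SPIT of shape $\alpha$. $|T|$ is the number of boxes of $T$. Column reading $\mathrm{w}_{\rm c}(T)$: read entries column by column starting from the leftmost column, each column from bottom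 to top. Row reading $\mathrm{w}_{\rm r}(T)$: read entries row by row starting from the uppermost row, each row from left to right. For a word $w$ with distinct positive integer letters, $\mathrm{Des}(w)$ (resp. $\mathrm{Asc}(w)$) is the set of $i$ such that $i$ and $i+1$ both occur in $w$ and $i$ is to the right (resp. left) of $i+1$. $T_{[1:j]}$ is the restriction of $T$ to its first $j$ boxes, boxes being listed column by column from left to right and from bottom to top in each column. $s_i\cdot T$ is obtained from $T$ by swapping the entries $i$ and $i+1$ (both occurring in $T$). A pair $(T,U)$ of generalized SPITs satisfies the shape-descent alignment condition if: $|U|=|T|-1$; the shape of $T$ has at least one part $\ge 3$ and $U$ has the same shape as $T_{[1:|U|]}$; $U$ and $T_{[1:|U|]}$ have the same set of entries; and $\mathrm{Des}(\mathrm{w}_{\rm r}(U))=\mathrm{Des}(\mathrm{w}_{\rm c}(T_{[1:|U|]}))$. Algorithm applied to such a pair $(T,U)$. Let $h$ be the entry in $T$ but not in $U$, at position $(x,y)$ in $T$. Step 1: set $j:=1$ and let $U^h_1$ be $U$ with a box added at $(x,y)$ filled with $h$. Step 2: let $A_j:=\mathrm{Des}(\mathrm{w}_{\rm r}(U^h_j))\cap\mathrm{Asc}(\mathrm{w}_{\rm c}(T))$ and $B_j:=\mathrm{Asc}(\mathrm{w}_{\rm r}(U^h_j))\cap\mathrm{Des}(\mathrm{w}_{\rm c}(T))$. If $A_j=B_j=\emptyset$, return $U^h_j$; otherwise go to Step 3. Step 3: if $A_j\neq\emptyset$ let $a$ be its unique element; if $B_j\ne\emptyset$ let $b$ be its unique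 element. Put $z_j:=a$ if $A_j,B_j\neq\emptyset$, $b=a+1$ and $a$ is in a row strictly below $a+2$ in $U^h_j$; $z_j:=a+1$ if $A_j,B_j\ne\emptyset$, $b=a+1$ and $a$ is in a row weakly above $a+2$ in $U^h_j$; $z_j:=a$ if $A_j\ne\emptyset$, $B_j=\emptyset$; $z_j:=b$ if $A_j=\emptyset$, $B_j\neq\emptyset$. Set $U^h_{j+1}:=s_{z_j}\cdot U^h_j$, increase $j$ by $1$, go to Step 2. The map $\Xi_\alpha$: let $\alpha$ be a peak composition of $n$ and $\mathfrak c:=c_1(\alpha)+c_2(\alpha)$. For $T\in\mathrm{SPIT}(\alpha)$ put $U_0(T):=T_{[1:\mathfrak c]}$ and, for $1\le i\le n-\mathfrak c$, let $U_i(T)$ be the filling returned by the Algorithm applied to $(T_{[1:\mathfrak c+i]},U_{i-1}(T))$. Set $\Xi_\alpha(T):=U_{n-\mathfrak c}(T)$. ''Well-defined'' means that this construction can always be carried out and yields an element of $\mathrm{SPIT}(\alpha)$. *)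

(* Defs.v *)
From mathcomp Require Import all_boot.

Set Implicit Arguments.
Unset Strict Implicit.
Unset Printing Implicit Defensive.

(** * Compositions and their diagrams *)

Definition is_composition (alpha : seq nat) : bool := all (leq 1) alpha.

Definition is_peak_composition (alpha : seq nat) : bool :=
  is_composition alpha && all (leq 2) (take (size alpha).-1 alpha).

(** [col_size alpha i] is the paper's c_i(alpha), columns being numbered from 1
    here only. *)
Definition col_size (alpha : seq nat) (i : nat) : nat := count (leq i) alpha.

(** A box is a pair (column, row); both coordinates start at 0. *)
Definition box : Type := (nat * nat)%type.

(** The diagram of [alpha], listed column by column from left to right and from
    bottom to top in each column. *)
Definition boxes (alpha : seq nat) : seq box :=
  [seq (i, j) | i <- iota 0 (\max_(a <- alpha) a),
                j <- [seq j <- iota 0 (size alpha) | i < nth 0 alpha j]].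

(** * Fillings *)

(** A filling is the list of its rows, from bottom to top; the library function
    [shape] gives the list of the lengths of its rows. *)
Definition filling : Type := seq (seq nat).

Definition entry (T : filling) (b : box) : nat := nth 0 (nth [::] T b.2) b.1.

Definition entries (T : filling) : seq nat := flatten T.

Definition num_boxes (T : filling) : nat := sumn (shape T).

Definition is_SIT (alpha : seq nat) (T : filling) : Prop :=
  [/\ shape T = alpha,
      perm_eq (entries T) (iota 1 (sumn alpha)),
      all (sorted ltn) T
    & sorted ltn [seq entry T (0, j) | j <- iota 0 (size T)]].

Definition is_SPIT (alpha : seq nat) (T : filling) : Prop :=
  is_SIT alpha T /\
  forall k, 1 <= k <= sumn alpha ->
    exists2 beta, is_peak_composition beta
      & [seq b <- boxes alpha | entry T b <= k] =i boxes beta.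

Definition SPIT (alpha : seq nat) : Type := {T : filling | is_SPIT alpha T}.

(** Replaces the [i]-th smallest entry by [i]. *)
Definition standardize (T : filling) : filling :=
  [seq [seq (index e (sort leq (entries T))).+1 | e <- r] | r <- T].

Definition is_gen_SPIT (alpha : seq nat) (T : filling) : Prop :=
  [/\ is_peak_composition alpha, shape T = alpha,
      uniq (entries T), all (leq 1) (entries T)
    & is_SPIT alpha (standardize T)].

(** * Reading words, descents and ascents *)

Definition col_word (T : filling) : seq nat :=
  [seq entry T b | b <- boxes (shape T)].

Definition row_word (T : filling) : seq nat := flatten (rev T).

Definition Des (w : seq nat) : pred nat :=
  [pred i | [&& i \in w, i.+1 \in w & index i.+1 w < index i w]].

Definition Asc (w : seq nat) : pred nat :=
  [pred i | [&& i \in w, i.+1 \in w & index i w < index i.+1 w]].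

(** * Operations on fillings *)

(** [restrict j T] is T_{[1:j]}.  Within a row the boxes are listed from left to
    right; rows left without any box (necessarily the top ones when the shape of
    [T] is a composition) are dropped. *)
Definition restrict (j : nat) (T : filling) : filling :=
  [seq r <- [seq [seq entry T b | b <- take j (boxes (shape T)) & b.2 == y]
            | y <- iota 0 (size T)]
  | r != [::]].

Definition add_box (U : filling) (b : box) (h : nat) : filling :=
  set_nth [::] U b.2 (set_nth 0 (nth [::] U b.2) b.1 h).

Definition swap (i : nat) (T : filling) : filling :=
  [seq [seq [fun e => e with i |-> i.+1, i.+1 |-> i] e | e <- r] | r <- T].

Definition row_of (T : filling) (e : nat) : nat :=
  find (fun r : seq nat => e \in r) T.

(** * The algorithm *)

Definition shape_descent_aligned (T U : filling) : Prop :=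
  [/\ is_gen_SPIT (shape T) T, is_gen_SPIT (shape U) U
    & (num_boxes U).+1 = num_boxes T] /\
  [/\ has (leq 3) (shape T),
      shape U = shape (restrict (num_boxes U) T),
      entries U =i entries (restrict (num_boxes U) T)
    & Des (row_word U) =i Des (col_word (restrict (num_boxes U) T))].

Definition setA (T V : filling) : pred nat :=
  [predI Des (row_word V) & Asc (col_word T)].

Definition setB (T V : filling) : pred nat :=
  [predI Asc (row_word V) & Des (col_word T)].

(** [pivot T V z]: Step 3, performed on the current filling [V], selects z_j = z.
    No constructor applies when A_j or B_j has more than one element, or when
    both are nonempty and b <> a + 1; the algorithm is then stuck. *)
Inductive pivot (T V : filling) : nat -> Prop :=
| pivot_below a : setA T V =i pred1 a -> setB T V =i pred1 a.+1 ->
    row_of V a < row_of V a.+2 -> pivot T V a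
| pivot_above a : setA T V =i pred1 a -> setB T V =i pred1 a.+1 ->
    row_of V a.+2 <= row_of V a -> pivot T V a.+1
| pivot_A a : setA T V =i pred1 a -> setB T V =i pred0 -> pivot T V a
| pivot_B b : setA T V =i pred0 -> setB T V =i pred1 b -> pivot T V b.

(** [loop T V W]: started at Step 2 with current filling [V], the algorithm
    terminates and returns [W]. *)
Inductive loop (T : filling) : filling -> filling -> Prop :=
| loop_return V : setA T V =i pred0 -> setB T V =i pred0 -> loop T V V
| loop_swap V z W : pivot T V z -> loop T (swap z V) W -> loop T V W.

(** The algorithm is only applied to aligned pairs, for which the box [b] below
    exists and is unique. *)
Definition algorithm_returns (T U W : filling) : Prop :=
  shape_descent_aligned T U /\
  exists2 b, (b \in boxes (shape T)) && (entry T b \notin entries U)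
    & loop T (add_box U b (entry T b)) W.

(** * The map Xi *)

Definition col12 (alpha : seq nat) : nat := col_size alpha 1 + col_size alpha 2.

(** [Xi_stage alpha T i U]: the construction can be carried out up to stage [i],
    and U_i(T) = U. *)
Inductive Xi_stage (alpha : seq nat) (T : filling) : nat -> filling -> Prop :=
| Xi_stage0 : Xi_stage alpha T 0 (restrict (col12 alpha) T)
| Xi_stageS i U W : Xi_stage alpha T i U ->
    algorithm_returns (restrict (col12 alpha + i.+1) T) U W ->
    Xi_stage alpha T i.+1 W.

(** The graph of Xi_alpha: the whole construction can be carried out from [T] and
    yields [V]. *)
Definition Xi_yields (alpha : seq nat) (T V : filling) : Prop :=
  Xi_stage alpha T (sumn alpha - col12 alpha) V.

(* Main.v *)
Require Import Defs.
From mathcomp Require Import all_boot zify.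
From Stdlib Require Import IndefiniteDescription.

(** An SPIT is a filling with increasing rows in which every entry of the second
    column is smaller than the entry starting the next row; so the only order
    constraints on a box outside the first two columns come from its row.

    Let [q] be the box added at some stage and [h] its entry.  A run of the
    algorithm moves the entry at [q] away from [h] in one direction, one unit at
    a time, and all the other entries it meets are shifted by one: the result is
    the initial filling relabelled by a cyclic permutation [cyc h e] of an
    interval of present values, which changes the relative order of the entry
    at [q] only.  The values met all lie in rows below [q], and their reading
    positions are monotone; this is what makes A and B singletons and
    determines when the loop stops.

    The row of [q] stays increasing because an entry present at some stage is
    only shifted within an interval of present values, hence never crosses an
    entry of [T] that is still to be added.  So if [T b < f] for a later entry
    [f], then also [U_i b < f]; for the left neighbour of [q] and [f = h] this
    says that it is smaller than [h], and being in the row of [q] it is not one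
    of the values met by the loop. *)

Set Implicit Arguments.
Unset Strict Implicit.
Unset Printing Implicit Defensive.

(** * Sequences and boxes *)

Section SeqLemmas.

Lemma filter_sorted_down (T : eqType) (lt : rel T) (P : pred T) (s : seq T) :
  transitive lt -> (forall x y, lt x y -> P y -> P x) -> sorted lt s ->
  [seq x <- s | P x] = take (count P s) s.
Proof.
move=> lt_tr Pdown; elim: s => //= x s IHs.
rewrite path_sortedE // => /andP[/allP x_s /IHs ->].
case: ifP => //= Px; rewrite add0n.
suff /eqP -> : count P s == 0 by rewrite take0.
rewrite eqn0Ngt -has_count; apply/hasP => -[y /x_s xy /(Pdown _ _ xy)].
by rewrite Px.
Qed.

Lemma filter_take (T : Type) (P : pred T) (s : seq T) j :
  [seq x <- take j s | P x] = take (count P (take j s)) [seq x <- s | P x].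
Proof.
rewrite -{3}(cat_take_drop j s) filter_cat.
by rewrite take_cat size_filter ltnn subnn take0 cats0.
Qed.

Lemma pairwise_allpairs (S T R : Type) (rS : rel S) (rT : rel T) (r : rel R)
    (f : S -> T -> R) (s : seq S) (t : S -> seq T) :
    (forall i i' j j', rS i i' -> r (f i j) (f i' j')) ->
    (forall i j j', rT j j' -> r (f i j) (f i j')) ->
    pairwise rS s -> (forall i, pairwise rT (t i)) ->
  pairwise r [seq f i j | i <- s, j <- t i].
Proof.
move=> rSr rTr + tP; elim: s => //= i s IHs /andP[is_ /IHs IH].
rewrite pairwise_cat IH andbT; apply/andP; split.
  elim: (t i) => //= j u; rewrite !allrel_consl => ->; rewrite andbT.
  elim: s is_ {IHs IH} => //= i' s IHs /andP[ii' /IHs]; rewrite all_cat => ->.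
  by rewrite andbT all_map; elim: (t i') => //= j' w ->; rewrite rSr.
rewrite pairwise_map; apply: sub_pairwise (tP i) => j j'; exact: rTr.
Qed.

Lemma uniq_map_inj_in (T1 T2 : eqType) (f : T1 -> T2) (s : seq T1) :
  uniq [seq f x | x <- s] -> {in s &, injective f}.
Proof.
elim: s => //= x s IHs /andP[fx /IHs inj] y z.
rewrite !inE => /predU1P[->|ys] /predU1P[->|zs] // e.
- by move: fx; rewrite e map_f.
- by move: fx; rewrite -e map_f.
- exact: inj.
Qed.

(** Turns the order of distinct letters in a reading word into the order of the boxes that carry
    them. *)
Lemma index_map_sorted (T1 T2 : eqType) (lt : rel T1) (f : T1 -> T2) s :
    transitive lt -> irreflexive lt -> sorted lt s -> {in s &, injective f} ->
  {in s &, forall b c, (index (f b) (map f s) < index (f c) (map f s)) = lt b c}.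
Proof.
move=> tr irr srt inj b c bs cs.
have idx x : x \in s -> index (f x) (map f s) = index x s.
  elim: s inj {srt bs cs} => //= y s IHs inj.
  rewrite inE [x == y]eq_sym; case: (eqVneq y x) => [->|nyx] /= => [|xs].
    by rewrite eqxx.
  rewrite IHs //; last by move=> u v us vs; apply: inj; rewrite inE ?us ?vs orbT.
  by case: eqP => // e; case/eqP: nyx; apply: inj; rewrite ?inE ?xs ?eqxx ?orbT.
rewrite !idx //; case: ltnP => [/(sorted_ltn_index tr srt)-> //|].
rewrite leq_eqVlt => /predU1P[e|/(sorted_ltn_index tr srt) cb].
  have -> : c = b by rewrite -(nth_index b cs) e nth_index.
  by rewrite irr.
apply/esym/negP => /(tr _ _ _ (cb cs bs)); by rewrite irr.
Qed.

Lemma sorted_count_leq (s : seq nat) i k : sorted ltn s ->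
  (i < count (fun e => e <= k) s) = (i < size s) && (nth 0 s i <= k).
Proof.
move=> srt.
have E : [seq e <- s | e <= k] = take (count (fun e => e <= k) s) s.
  apply: filter_sorted_down ltn_trans _ srt => x y /ltnW xy; exact: leq_trans.
case: ltnP => [lt|ge].
  have le := count_size (fun e => e <= k) s.
  rewrite (leq_trans lt le) -(nth_take 0 lt) -E.
  have /allP all_le := filter_all (fun e => e <= k) s; apply/esym/all_le.
  by apply: mem_nth; rewrite size_filter.
case: ltnP => //= lt; apply/esym/negP => le.
have : nth 0 s i \in [seq e <- s | e <= k] by rewrite mem_filter le mem_nth.
rewrite E => /(nthP 0)[j]; rewrite size_take => jlt.
have jc : j < count (fun e => e <= k) s by move: jlt; case: ifP => // ; lia.
rewrite nth_take // => ji.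
have jlti : j < i by lia.
have js : j < size s by lia.
by have := sorted_ltn_nth ltn_trans 0 srt j i js lt jlti; rewrite ji /= ltnn.
Qed.

Lemma index_rcons_last (T : eqType) (s : seq T) x :
  x \notin s -> index x (rcons s x) = size s.
Proof. by move=> xs; rewrite -cats1 index_cat (negPf xs) /= eqxx addn0. Qed.

Lemma index_rcons_in (T : eqType) (s : seq T) x z :
  x \in s -> index x (rcons s z) = index x s.
Proof. by move=> xs; rewrite -cats1 index_cat xs. Qed.

End SeqLemmas.

(** * Boxes of a diagram in column and row reading order *)

Section Boxes.

Definition col_lt (b c : box) : bool :=
  (b.1 < c.1) || ((b.1 == c.1) && (b.2 < c.2)).

Definition row_lt (b c : box) : bool :=
  (c.2 < b.2) || ((b.2 == c.2) && (b.1 < c.1)).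

Definition row_boxes (alpha : seq nat) : seq box :=
  [seq (i, j) | j <- rev (iota 0 (size alpha)), i <- iota 0 (nth 0 alpha j)].

Lemma col_lt_trans : transitive col_lt.
Proof. move=> [? ?] [? ?] [? ?]; rewrite /col_lt /=; lia. Qed.

Lemma col_lt_irr : irreflexive col_lt.
Proof. move=> [? ?]; rewrite /col_lt /=; lia. Qed.

Lemma row_lt_trans : transitive row_lt.
Proof. move=> [? ?] [? ?] [? ?]; rewrite /row_lt /=; lia. Qed.

Lemma row_lt_irr : irreflexive row_lt.
Proof. move=> [? ?]; rewrite /row_lt /=; lia. Qed.

Lemma nth0_size (alpha : seq nat) i j : i < nth 0 alpha j -> j < size alpha.
Proof. by case: (ltnP j (size alpha)) => // ?; rewrite nth_default. Qed.

Lemma mem_boxes alpha b : (b \in boxes alpha) = (b.1 < nth 0 alpha b.2).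
Proof.
case: b => i j /=; apply/allpairsPdep/idP => [[x [y []]]|lt].
  by rewrite mem_filter => _ /andP[? _] [-> ->].
have js := nth0_size lt; exists i, j; rewrite mem_filter !mem_iota /= !add0n lt.
by split=> //; apply: leq_trans lt _; apply: leq_bigmax_seq; rewrite ?mem_nth.
Qed.

Lemma boxes_sorted alpha : sorted col_lt (boxes alpha).
Proof.
apply: pairwise_sorted; apply: (@pairwise_allpairs _ _ _ ltn ltn).
- by move=> i i' j j'; rewrite /col_lt /= => ->.
- by move=> i j j'; rewrite /col_lt /= eqxx => ->; rewrite orbT.
- by rewrite -sorted_pairwise ?iota_ltn_sorted //; apply: ltn_trans.
- move=> i; rewrite -sorted_pairwise; last exact: ltn_trans.
  by rewrite sorted_filter ?iota_ltn_sorted //; apply: ltn_trans.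
Qed.

Lemma boxes_uniq alpha : uniq (boxes alpha).
Proof. exact: (sorted_uniq col_lt_trans col_lt_irr) (boxes_sorted alpha). Qed.

Lemma mem_row_boxes alpha b : (b \in row_boxes alpha) = (b.1 < nth 0 alpha b.2).
Proof.
case: b => i j /=; apply/allpairsPdep/idP => [[x [y []]]|lt].
  by rewrite mem_iota => _ ? [-> ->].
by exists j, i; rewrite mem_rev !mem_iota /= !add0n (nth0_size lt).
Qed.

Lemma row_boxes_sorted alpha : sorted row_lt (row_boxes alpha).
Proof.
apply: pairwise_sorted.
apply: (@pairwise_allpairs _ _ _ (fun i j => j < i) ltn _ (fun j i => (i, j))).
- by move=> i i' j j'; rewrite /row_lt /= => ->.
- by move=> i j j'; rewrite /row_lt /= eqxx => ->; rewrite orbT.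
- rewrite -sorted_pairwise; last by move=> ? ? ? /=; lia.
  by rewrite rev_sorted iota_ltn_sorted.
- by move=> i; rewrite -sorted_pairwise ?iota_ltn_sorted //; apply: ltn_trans.
Qed.

(** Counted row by row: [row_boxes] lists the same boxes, and its size is directly the sum of the
    row lengths. *)
Lemma size_boxes alpha : size (boxes alpha) = sumn alpha.
Proof.
rewrite (@perm_size _ _ (row_boxes alpha)); last first.
  apply: uniq_perm; rewrite ?boxes_uniq //.
    exact: (sorted_uniq row_lt_trans row_lt_irr) (row_boxes_sorted alpha).
  by move=> b; rewrite mem_boxes mem_row_boxes.
rewrite size_allpairs_dep map_rev sumn_rev; congr sumn.
under eq_map => j do rewrite size_iota.
by rewrite map_nth_iota0 // take_size.
Qed.

Lemma eq_boxes alpha (s : seq box) :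
  sorted col_lt s -> s =i boxes alpha -> s = boxes alpha.
Proof.
move=> ? ?; apply: (irr_sorted_eq col_lt_trans col_lt_irr) => //.
exact: boxes_sorted.
Qed.

End Boxes.

(** * Fillings and tableaux *)

Section Fillings.

Implicit Types (V : filling) (b c : box).

Lemma nth_shape V j : nth 0 (shape V) j = size (nth [::] V j).
Proof.
case: (ltnP j (size V)) => jV; first by rewrite (nth_map [::]).
by rewrite !nth_default ?size_map.
Qed.

Lemma mem_shape_boxes V b : (b \in boxes (shape V)) = (b.1 < size (nth [::] V b.2)).
Proof. by rewrite mem_boxes nth_shape. Qed.

Lemma box_row_lt V b : b \in boxes (shape V) -> b.2 < size V.
Proof. by rewrite mem_boxes => /nth0_size; rewrite size_map. Qed.

(** Puts the row word in the form of the column word, a map over a sorted list of boxes, so that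
    [index_map_sorted] handles both. *)
Lemma row_word_boxes V : row_word V = [seq entry V b | b <- row_boxes (shape V)].
Proof.
rewrite map_allpairs /row_word; congr flatten.
rewrite -{1}[V]take_size -(map_nth_iota0 [::]) // -map_rev size_map.
apply: eq_map => j; rewrite nth_shape /entry /=.
by rewrite map_nth_iota0 // take_size.
Qed.

Lemma perm_row_word V : perm_eq (row_word V) (entries V).
Proof. by apply: perm_flatten; rewrite perm_rev. Qed.

Lemma perm_col_word V : perm_eq (col_word V) (entries V).
Proof.
apply: perm_trans (perm_row_word V); rewrite row_word_boxes; apply: perm_map.
apply: uniq_perm; first exact: boxes_uniq.
  exact: (sorted_uniq row_lt_trans row_lt_irr) (row_boxes_sorted _).
by move=> b; rewrite mem_boxes mem_row_boxes.
Qed.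

Lemma mem_row_word V : row_word V =i entries V.
Proof. exact/perm_mem/perm_row_word. Qed.

Lemma mem_col_word V : col_word V =i entries V.
Proof. exact/perm_mem/perm_col_word. Qed.

Lemma mem_entry V b : b \in boxes (shape V) -> entry V b \in entries V.
Proof. by move=> bV; rewrite -mem_col_word map_f. Qed.

Lemma entriesP V v :
  reflect (exists2 b, b \in boxes (shape V) & v = entry V b) (v \in entries V).
Proof. by rewrite -mem_col_word; apply: mapP. Qed.

Lemma entry_inj V : uniq (entries V) -> {in boxes (shape V) &, injective (entry V)}.
Proof. by rewrite -(perm_uniq (perm_col_word V)); apply: uniq_map_inj_in. Qed.

Lemma index_row_word V : uniq (entries V) ->
  {in boxes (shape V) &, forall b c,
    (index (entry V b) (row_word V) < index (entry V c) (row_word V)) = row_lt b c}.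
Proof.
move=> uV b c bV cV; rewrite row_word_boxes.
rewrite (index_map_sorted row_lt_trans row_lt_irr (row_boxes_sorted _)) //.
- by move=> ? ? ? ?; apply: (entry_inj uV); rewrite mem_boxes -mem_row_boxes.
- by rewrite mem_row_boxes -mem_boxes.
- by rewrite mem_row_boxes -mem_boxes.
Qed.

Lemma index_col_word V : uniq (entries V) ->
  {in boxes (shape V) &, forall b c,
    (index (entry V b) (col_word V) < index (entry V c) (col_word V)) = col_lt b c}.
Proof.
move=> uV; apply: (index_map_sorted col_lt_trans col_lt_irr (boxes_sorted _)).
exact: entry_inj.
Qed.

End Fillings.

(** * Peak tableaux as fillings with a chain condition *)

Section Tableaux.

Implicit Types (V : filling) (alpha : seq nat).

(** With increasing rows, this makes the first two columns a chain for the order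
    on entries, read row by row from bottom to top. *)
Definition chain V : Prop :=
  forall y, y.+1 < size V -> entry V (1, y) < entry V (0, y.+1).

(** The boolean [y.+1 < size alpha] is read as 0 or 1: one inequality asks for at least 2 before the
    last part and at least 1 there. *)
Lemma peak_compositionP alpha :
  reflect (forall y, y < size alpha -> (y.+1 < size alpha) < nth 0 alpha y)
    (is_peak_composition alpha).
Proof.
apply: (iffP andP) => [[/(all_nthP 0) pos /(all_nthP 0) ge2] y ylt|H].
  case: (ltnP y.+1) => ySlt; last exact: pos.
  have := ge2 y; rewrite size_take nth_take; try lia.
  by case: ifP => _; apply; lia.
split; apply/(all_nthP 0) => y; first by move/H; lia.
rewrite size_take => ylt; rewrite nth_take; last by move: ylt; case: ifP; lia.
have /H : y < size alpha by move: ylt; case: ifP; lia.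
by move: ylt; case: ifP; lia.
Qed.

Lemma entry_row_lt V i i' j : all (sorted ltn) V ->
  i < i' -> (i', j) \in boxes (shape V) -> entry V (i, j) < entry V (i', j).
Proof.
move=> /(all_nthP [::]) srt lt i'jV; have jV := box_row_lt i'jV.
move: i'jV; rewrite mem_shape_boxes /= => i'j.
apply: (sorted_ltn_nth ltn_trans 0 (srt j jV)) => //; rewrite inE //.
exact: ltn_trans i'j.
Qed.

Lemma peak_boxes V : is_peak_composition (shape V) -> forall y, y < size V ->
  ((0, y) \in boxes (shape V)) /\ (y.+1 < size V -> (1, y) \in boxes (shape V)).
Proof.
move=> /peak_compositionP pk y; rewrite !mem_boxes /= -(size_map size) => ylt.
have := pk y ylt; rewrite -/(shape V); lia.
Qed.

Lemma chain_lt V : is_peak_composition (shape V) -> all (sorted ltn) V -> chain V ->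
  forall y y', y < y' < size V -> entry V (1, y) < entry V (0, y').
Proof.
move=> pk srt ch y; elim=> // y' IHy /andP[]; rewrite ltnS leq_eqVlt.
case/predU1P => [<-|yy'] y'V; first exact: ch.
apply: ltn_trans (IHy _) (ltn_trans _ (ch _ y'V)); first lia.
by apply: entry_row_lt => //; apply: (peak_boxes pk _).2 => //; lia.
Qed.

Lemma chain_first_column V : is_peak_composition (shape V) -> all (sorted ltn) V ->
  chain V -> sorted ltn [seq entry V (0, j) | j <- iota 0 (size V)].
Proof.
move=> pk srt ch; apply/(sortedP 0) => j; rewrite size_map size_iota => jlt.
rewrite !(nth_map 0) ?size_iota ?nth_iota //; try lia.
apply: ltn_trans (ch j jlt); apply: entry_row_lt => //.
by apply: (peak_boxes pk _).2 => //; lia.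
Qed.

(** The rows started by an entry at most [k] are the lowest ones. If the next row is started too,
    the chain puts the second entry of the row below that start, hence at most [k]; so every part
    but the last is at least 2. *)
Lemma chain_prefix V k : is_peak_composition (shape V) -> all (sorted ltn) V ->
  chain V ->
  exists2 beta, is_peak_composition beta
    & [seq b <- boxes (shape V) | entry V b <= k] =i boxes beta.
Proof.
move=> pk srt ch; set col0 := [seq entry V (0, j) | j <- iota 0 (size V)].
have srt0 : sorted ltn col0 by apply: chain_first_column.
have size0 : size col0 = size V by rewrite size_map size_iota.
pose m := count (fun e => e <= k) col0.
have mP y : (y < m) = (y < size V) && (entry V (0, y) <= k).
  rewrite /m sorted_count_leq // size0; case: ltnP => //= yV.
  by rewrite (nth_map 0) ?size_iota // nth_iota.
have mV : m <= size V by rewrite -size0 count_size.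
pose rowk y := count (fun e => e <= k) (nth [::] V y).
have rowkP x y : y < size V ->
    (x < rowk y) = ((x, y) \in boxes (shape V)) && (entry V (x, y) <= k).
  move=> yV; rewrite /rowk sorted_count_leq ?mem_shape_boxes //.
  by move/(all_nthP [::]): srt; apply.
exists (mkseq rowk m).
  apply/peak_compositionP => y; rewrite size_mkseq => ym; rewrite nth_mkseq //.
  have yV : y < size V by lia.
  have [y0 y1] := peak_boxes pk yV.
  case: (ltnP y.+1) => ySm; rewrite rowkP ?y0 //; last by move: ym; rewrite mP => /andP[].
  move: ySm; rewrite mP => /andP[ySV le]; rewrite y1 //=.
  by apply: leq_trans le; apply: ltnW; apply: ch.
move=> [x y]; rewrite mem_filter andbC [RHS]mem_boxes /=; case: (ltnP y m) => ym.
  by rewrite nth_mkseq // rowkP //; apply: leq_trans mV.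
(* From row [m] upwards no entry is at most [k], since the first entry of its row would be too. *)
rewrite (nth_default 0 (s := mkseq _ _)) ?size_mkseq // ltn0.
apply/negP => /andP[xy le]; move: ym; rewrite leqNgt => /negP; apply.
have yV : y < size V := box_row_lt xy.
rewrite mP yV /=; apply: leq_trans le.
by case: x xy => // x xy; apply/ltnW/entry_row_lt.
Qed.

(** Replaces the condition on all sub-diagrams by local inequalities, which are what the algorithm
    can be shown to preserve. *)
Lemma is_SPITP alpha V : is_peak_composition alpha ->
  is_SPIT alpha V <->
  [/\ shape V = alpha, perm_eq (entries V) (iota 1 (sumn alpha)),
      all (sorted ltn) V & chain V].
Proof.
move=> pk; split => [[[shV pV srt col] pre]|[shV pV srt ch]].
  split=> // y yV.
  have pkV : is_peak_composition (shape V) by rewrite shV.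
  have [y0 _] := peak_boxes pkV yV.
  (* Take [k] to be the entry starting row [y.+1]: row [y] is not the last row of the sub-diagram,
     so it contains [(1, y)], and distinctness of the entries makes the inequality strict. *)
  have : entry V (0, y.+1) \in iota 1 (sumn alpha).
    by rewrite -(perm_mem pV) mem_entry.
  rewrite mem_iota add1n ltnS => /pre[beta /peak_compositionP pkb eqb].
  have := eqb (0, y.+1); rewrite mem_filter leqnn -shV y0 mem_boxes /=.
  move/esym => y0b; have ySb := nth0_size y0b.
  have : (1, y) \in boxes beta.
    by rewrite mem_boxes; have := pkb y; rewrite ySb /=; apply; lia.
  rewrite -eqb mem_filter -shV leq_eqVlt => /andP[/predU1P[|] // + y1].
  have uV : uniq (entries V) by rewrite (perm_uniq pV) iota_uniq.
  by move/(entry_inj uV) => /(_ y1 y0).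
have pkV : is_peak_composition (shape V) by rewrite shV.
split; last by move=> k _; rewrite -shV; apply: chain_prefix.
by split=> //; apply: chain_first_column.
Qed.

Lemma index_sort_ltn (s : seq nat) : uniq s ->
  {in s &, {mono (fun e => index e (sort leq s)) : x y / x < y}}.
Proof.
move=> us x y xs ys; have := sort_sorted leq_total s.
set t := sort leq s => srt; have xt : x \in t by rewrite mem_sort.
have yt : y \in t by rewrite mem_sort.
have srt' : sorted ltn t by rewrite ltn_sorted_uniq_leq sort_uniq us.
have := @index_map_sorted _ _ ltn id t ltn_trans ltnn srt' (in2W (@inj_id nat)) x y xt yt.
by rewrite map_id.
Qed.

(** Replacing entries by their ranks is strictly increasing, so it preserves the rows and the
    chain. *)
Lemma is_gen_SPIT_chain V : is_peak_composition (shape V) ->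
  uniq (entries V) -> all (leq 1) (entries V) -> all (sorted ltn) V -> chain V ->
  is_gen_SPIT (shape V) V.
Proof.
move=> pk uV posV srt ch; split=> //.
pose st e := (index e (sort leq (entries V))).+1.
have stE : standardize V = [seq [seq st e | e <- r] | r <- V] by [].
have sh : shape (standardize V) = shape V.
  by rewrite stE /shape -map_comp; apply: eq_map => r /=; rewrite size_map.
have st_lt : {in entries V &, {mono st : x y / x < y}}.
  by move=> x y xV yV; rewrite /st ltnS index_sort_ltn.
have ent b : b \in boxes (shape V) -> entry (standardize V) b = st (entry V b).
  move=> bV; have b2 := box_row_lt bV; move: bV; rewrite mem_shape_boxes stE /entry => bV.
  by rewrite (nth_map [::]) // (nth_map 0).
apply/is_SPITP => //; split=> //.
- have -> : entries (standardize V) = [seq st e | e <- entries V].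
    by rewrite stE /entries map_flatten.
  (* In sorted order, the entry at index [i] has rank [i.+1], so the image is literally an
     [iota]. *)
  apply: (perm_trans (y := [seq st e | e <- sort leq (entries V)])).
    by apply: perm_map; rewrite perm_sym perm_sort.
  set t := sort _ _; have ut : uniq t by rewrite sort_uniq.
  have szt : size t = sumn (shape V) by rewrite size_sort size_flatten.
  suff -> : [seq st e | e <- t] = iota 1 (sumn (shape V)) by [].
  apply: (@eq_from_nth _ 0) => [|i]; rewrite size_map ?size_iota ?szt // => it.
  by rewrite (nth_map 0) ?szt // nth_iota // /st index_uniq ?szt.
- rewrite stE all_map; apply/allP => r rV /=.
  apply: (homo_sorted_in (P := [in r])) (allP srt r rV); last by apply/allP.
  move=> x y xr yr /=; rewrite st_lt //; apply/flattenP; by exists r.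
- move=> y; rewrite size_map => yV.
  have [y0 _] := peak_boxes pk yV; have [_ y1] := peak_boxes pk (ltnW yV).
  by rewrite !ent ?y1 // st_lt ?mem_entry ?y1 //; apply: ch.
Qed.

End Tableaux.

(** * The loop *)

Section Cycle.

(** The cyclic permutation of the interval between [h] and [e] that sends [h]
    to [e] and moves the other values one step towards [h]. *)
Definition cyc (h e v : nat) : nat :=
  if v == h then e else if e <= v < h then v.+1
  else if h < v <= e then v.-1 else v.

Variant cyc_spec h e v : nat -> Prop :=
| CycFix of v = h : cyc_spec h e v e
| CycUp of e <= v < h : cyc_spec h e v v.+1
| CycDown of h < v <= e : cyc_spec h e v v.-1
| CycOut of v < minn h e \/ maxn h e < v : cyc_spec h e v v.

Lemma cycP h e v : cyc_spec h e v (cyc h e v).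
Proof.
rewrite /cyc; case: eqVneq => [|vh]; first by constructor.
by case: ifP => [|I1]; [|case: ifP => [|I2]]; constructor => //; lia.
Qed.

Lemma cycK h e : cancel (cyc h e) (cyc e h).
Proof. by move=> v; case: (cycP h e v) => ?; case: cycP; lia. Qed.

(** The inverse cycle exchanges the roles of [h] and [e]. *)
Lemma cyc_inj h e : injective (cyc h e).
Proof. exact: can_inj (@cycK h e). Qed.

Lemma cyc_mono h e v v' : v != h -> v' != h -> (cyc h e v < cyc h e v') = (v < v').
Proof. by case: (cycP h e v) => ?; case: (cycP h e v'); lia. Qed.

(** [cyc] permutes the interval and fixes everything else, so a set containing the interval is
    stable. *)
Lemma mem_cyc h e (P : pred nat) :
  (forall v, (e <= v <= h) || (h <= v <= e) -> P v) -> forall v, P (cyc h e v) = P v.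
Proof.
move=> H v; case: (boolP ((e <= v <= h) || (h <= v <= e))) => vI.
  by rewrite !H //; case: cycP; lia.
by congr P; case: cycP; lia.
Qed.

(** A value outside [P] lies outside the interval, hence below or above all of it, and no value is
    carried across it. *)
Lemma cyc_lt h e (P : pred nat) v f :
    (forall v, (e <= v <= h) || (h <= v <= e) -> P v) -> ~~ P f ->
  v < f -> cyc h e v < f.
Proof.
move=> H Pf vf; have : ~~ ((e <= f <= h) || (h <= f <= e)).
  by apply: contra Pf; exact: H.
case: cycP; lia.
Qed.

End Cycle.

(** * Relabelled fillings and adjacent swaps *)

Section Relabel.

Implicit Types (V : filling) (f : nat -> nat).

Definition relabel f V : filling := [seq [seq f e | e <- r] | r <- V].

Lemma shape_relabel f V : shape (relabel f V) = shape V.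
Proof. by rewrite /shape -map_comp; apply: eq_map => r /=; rewrite size_map. Qed.

Lemma entries_relabel f V : entries (relabel f V) = [seq f e | e <- entries V].
Proof. by rewrite /entries map_flatten. Qed.

Lemma row_word_relabel f V : row_word (relabel f V) = [seq f e | e <- row_word V].
Proof. by rewrite /row_word map_flatten map_rev. Qed.

Lemma entry_relabel f V b :
  b \in boxes (shape V) -> entry (relabel f V) b = f (entry V b).
Proof.
move=> bV; have b2 := box_row_lt bV; move: bV; rewrite mem_shape_boxes /entry => bV.
by rewrite (nth_map [::]) // (nth_map 0).
Qed.

Lemma relabel_id f V : f =1 id -> relabel f V = V.
Proof.
move=> fid; rewrite -[RHS]map_id; apply: eq_map => r.
by rewrite -[RHS]map_id; apply: eq_map.
Qed.

Lemma swap_relabel z f g V :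
    (forall v, [fun e => e with z |-> z.+1, z.+1 |-> z] (f v) = g v) ->
  swap z (relabel f V) = relabel g V.
Proof.
move=> H; rewrite /swap /relabel -map_comp; apply: eq_map => r /=.
by rewrite -map_comp; apply: eq_map => v; rewrite -H.
Qed.

(** One adjacent swap extends the cycle by one value at its end [e]; [swap_up] is the mirror
    case. *)
Lemma swap_down h e V : e < h ->
  swap e (relabel (cyc h e.+1) V) = relabel (cyc h e) V.
Proof.
move=> eh; apply: swap_relabel => v /=.
by case: (cycP h e.+1 v) => ?; case: (cycP h e v) => ?; do !case: eqP; lia.
Qed.

Lemma swap_up h e V : h <= e ->
  swap e (relabel (cyc h e) V) = relabel (cyc h e.+1) V.
Proof.
move=> eh; apply: swap_relabel => v /=.
by case: (cycP h e.+1 v) => ?; case: (cycP h e v) => ?; do !case: eqP; lia.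
Qed.

End Relabel.

(** * Discrepancies between two descent sets *)

Section Discrepancies.

Variables (T V : filling).
Hypothesis VT : row_word V =i col_word T.

Lemma mem_Asc (w : seq nat) i :
  (i \in Asc w) = [&& i \in w, i.+1 \in w & i \notin Des w].
Proof.
rewrite !inE; case: (boolP (i \in w)) => //= iw; case: (boolP (i.+1 \in w)) => //= iSw.
rewrite -leqNgt [RHS]leq_eqVlt; case: eqP => // e.
by have /eqP := index_inj 0 iw iSw e; rewrite -[_ == _]negbK neq_ltn ltnSn.
Qed.

Lemma Des_mem (w : seq nat) i : i \in Des w -> (i \in w) && (i.+1 \in w).
Proof. by rewrite !inE => /and3P[-> ->]. Qed.

(** For words with the same letters, an ascent is a non-descent between present values; so [setA]
    and [setB] are the two halves of the symmetric difference of the descent sets. *)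
Lemma mem_setA i :
  (i \in setA T V) = (i \in Des (row_word V)) && (i \notin Des (col_word T)).
Proof.
transitivity ((i \in Des (row_word V)) && (i \in Asc (col_word T))) => //.
by rewrite mem_Asc -!VT; case: (boolP (i \in Des _)) => //= /Des_mem/andP[-> ->].
Qed.

Lemma mem_setB i :
  (i \in setB T V) = (i \notin Des (row_word V)) && (i \in Des (col_word T)).
Proof.
transitivity ((i \in Asc (row_word V)) && (i \in Des (col_word T))) => //.
rewrite mem_Asc !VT [in RHS]andbC; case: (boolP (i \in Des (col_word T))); last by rewrite andbF.
by move=> /Des_mem/andP[-> ->]; rewrite !andbT.
Qed.

End Discrepancies.

(** * Runs of the loop as growing cycles *)

Section Loop.

Variables (T V : filling) (h : nat).

Let p v := index v (row_word V).
Let P := [in row_word V].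
Let tgt := Des (col_word T).

(** In the application [h] is the last letter of the column word, which gives [tgt_h] and
    [tgt_pred]; away from [h] the target agrees with the row word of [V]. [row_of_p] turns the row
    comparison of Step 3 into one of reading positions. *)
Hypothesis VT : row_word V =i col_word T.
Hypothesis hP : P h.
Hypothesis tgt_h : P h.+1 -> h \in tgt.
Hypothesis tgt_pred : forall a, a.+1 = h -> a \notin tgt.
Hypothesis tgt_other : forall i, i != h -> i.+1 != h ->
  (i \in tgt) = [&& P i, P i.+1 & p i.+1 < p i].
Hypothesis row_of_p : forall a, a.+1 = h -> P a -> P a.+2 ->
  (row_of V a < row_of V a.+2) = (p a.+2 < p a).

Definition between e v := (e <= v <= h) || (h <= v <= e).

Lemma p_neq a b : P a -> P b -> a != b -> p a != p b.
Proof. by move=> aP bP; apply: contra => /eqP /(index_inj 0 aP bP) ->. Qed.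

(** Relabelling moves no box: the value [v] is now read where [V] has its preimage [cyc e h v]. *)
Lemma Des_relabel e i : (forall v, between e v -> P v) ->
  (i \in Des (row_word (relabel (cyc h e) V)))
  = [&& P i, P i.+1 & p (cyc e h i.+1) < p (cyc e h i)].
Proof.
move=> eP; rewrite row_word_relabel.
have mem v : (v \in [seq cyc h e x | x <- row_word V]) = P v.
  rewrite -[v in LHS](@cycK e h) mem_map; last exact: cyc_inj.
  by apply: (mem_cyc (P := P)) => u ul; apply: eP; move: ul; rewrite /between; lia.
have idx v : index v [seq cyc h e x | x <- row_word V] = p (cyc e h v).
  by rewrite -[v in LHS](@cycK e h) index_map //; apply: cyc_inj.
by rewrite !inE !mem !idx.
Qed.

Lemma relabel_mem e : (forall v, between e v -> P v) ->
  row_word (relabel (cyc h e) V) =i col_word T.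
Proof.
move=> eP v; rewrite row_word_relabel -VT.
rewrite -[v in LHS](@cycK e h) mem_map; last exact: cyc_inj.
by apply: (mem_cyc (P := P)) => u ul; apply: eP; move: ul; rewrite /between; lia.
Qed.

(** The positions [p v] are those in the initial filling [V].  The last clause is
    where the comparison of rows in Step 3 enters. *)
Definition descending e :=
  [/\ e < h, forall v, e <= v < h -> P v /\ p h < p v,
      forall v, e <= v -> v.+1 < h -> p v < p v.+1
    & P h.+1 -> p h.+1 < p h.-1].

Definition ascending e :=
  [/\ h < e, forall v, h < v <= e -> P v /\ p h < p v,
      forall v, h < v < e -> p v.+1 < p v
    & forall a, a.+1 = h -> P a -> p a < p h.+1].

(** The second clause locates the values met; it later excludes the left neighbour of the new box,
    which is read before that box. *)
Definition loop_result V' e :=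
  [/\ forall v, between e v -> P v, forall v, v != h -> between e v -> p h < p v,
      loop T V' (relabel (cyc h e) V)
    & Des (row_word (relabel (cyc h e) V)) =i tgt].

Lemma descending_P e : descending e -> forall v, between e v -> P v.
Proof.
move=> [eh ev _ _] v; rewrite /between => vI.
have [->//|vh] := eqVneq v h; have [//|] := ev v; lia.
Qed.

Lemma descending_lt e : descending e ->
  forall v, v != h -> between e v -> p h < p v.
Proof.
by move=> [eh ev _ _] v vh; rewrite /between => vI; have [|] := ev v; first lia.
Qed.

Lemma ascending_lt e : ascending e ->
  forall v, v != h -> between e v -> p h < p v.
Proof.
by move=> [eh ev _ _] v vh; rewrite /between => vI; have [|] := ev v; first lia.
Qed.

Lemma ascending_P e : ascending e -> forall v, between e v -> P v.
Proof.
move=> [eh ev _ _] v; rewrite /between => vI.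
have [->//|vh] := eqVneq v h; have [//|] := ev v; lia.
Qed.

(** The values from [e] to [h] are now read at the increasing positions [p h], [p e], ..., [p h.-1],
    so none below [h] is a descent, as in the target. The last clause of [descending] settles [h]
    itself. Only the predecessor of [e] may disagree. *)
Lemma descending_Des e i : descending e -> i.+1 != e ->
  (i \in Des (row_word (relabel (cyc h e) V))) = (i \in tgt).
Proof.
move=> De ie; rewrite Des_relabel; last exact: descending_P.
case: (De) => eh ev inc hS.
have [ih|ih] := eqVneq i h.
  subst i; rewrite hP; case: (boolP (P h.+1)) => hSP /=; last first.
    by apply/esym/negP => /Des_mem/andP[_]; rewrite -VT; apply/negP.
  rewrite tgt_h //; case: (cycP e h h.+1); try lia; case: cycP; try lia.
have [iSh|iSh] := eqVneq i.+1 h.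
  rewrite (negPf (tgt_pred iSh)) iSh.
  apply/negP => /and3P[_ _]; case: (cycP e h h); try lia.
  case: cycP => [ie'|?|?|]; try lia; have [_] := ev h.-1 ltac:(lia); first lia.
  have := inc i.-1; have -> : i.-1.+1 = h.-1 by lia. lia.
rewrite tgt_other //; congr [&& _, _ & _].
have [iI|iO] := boolP (e <= i < h); last first.
  by case: (cycP e h i) => ?; case: (cycP e h i.+1) => *; congr (_ < _); congr p; lia.
have -> : (p i.+1 < p i) = false.
  by apply/negbTE; rewrite -leqNgt ltnW // inc; lia.
apply/negbTE; rewrite -leqNgt; case: (cycP e h i.+1) => [?|?|_|?]; try lia; rewrite [i.+1.-1]/=.
case: cycP => [_|?|ei|?]; try lia; first by have [] := ev i; lia.
by have := inc i.-1; case: (i) iI ei => [|j] /=; lia.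
Qed.

(** The values from [h] to [e] are now read at the decreasing positions [p h.+1], ..., [p e], [p h],
    so all those below [e] are descents, as in the target. The last clause of [ascending] settles
    the predecessor of [h]. Only [e] may disagree. *)
Lemma ascending_Des e i : ascending e -> i != e ->
  (i \in Des (row_word (relabel (cyc h e) V))) = (i \in tgt).
Proof.
move=> De ie; have eP := ascending_P De; rewrite Des_relabel //.
case: (De) => he ev dec hS.
have [iSh|iSh] := eqVneq i.+1 h.
  rewrite (negPf (tgt_pred iSh)) iSh; apply/negP => /and3P[Pi _].
  have := hS _ iSh Pi; case: (cycP e h h) => [?|?|?|?]; try lia.
  by case: cycP; lia.
have [iI|iO] := boolP (h <= i < e); last first.
  rewrite tgt_other //; last by lia.
  congr [&& _, _ & _].
  by case: (cycP e h i) => ?; case: (cycP e h i.+1) => *; congr (_ < _); congr p; lia.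
have Pi : P i by apply: eP; rewrite /between; lia.
have PiS : P i.+1 by apply: eP; rewrite /between; lia.
have -> : i \in tgt.
  have [ih|ih] := eqVneq i h; first by move: PiS; rewrite ih; apply: tgt_h.
  by rewrite tgt_other // Pi PiS dec //; lia.
rewrite Pi PiS /=; case: (cycP e h i) => [?|?|?|?]; try lia.
case: cycP => [iSe|?|?|?]; try lia; first by have [|] := ev i.+1; first lia.
by apply: dec; lia.
Qed.

Lemma loop_stop e : (forall v, between e v -> P v) ->
    (forall v, v != h -> between e v -> p h < p v) ->
    Des (row_word (relabel (cyc h e) V)) =i tgt ->
  loop_result (relabel (cyc h e) V) e.
Proof.
move=> eP ev agree; have mem := relabel_mem eP; split=> //.
apply: loop_return => i; first by rewrite mem_setA // agree andbN.
by rewrite mem_setB // agree andNb.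
Qed.

(** Each swap lowers [e], so the run ends at 0 at the latest, where no predecessor is left to
    disagree. *)
Lemma loop_descending e : descending e ->
  exists e', loop_result (relabel (cyc h e) V) e'.
Proof.
elim: e => [|e IHe] De; have eP := descending_P De; have mem := relabel_mem eP;
  have agree := descending_Des De; have ev' := descending_lt De;
  have [eh ev inc hS] := De.
  by eexists; apply: loop_stop eP ev' _ => i; apply: agree.
have [agree_e|neq_e] := eqVneq (e \in Des (row_word (relabel (cyc h e.+1) V))) (e \in tgt).
  by exists e.+1; apply: loop_stop eP ev' _ => i; have [->//|ie] := eqVneq i e;
    apply: agree.
have eSP : P e.+1 by apply: eP; rewrite /between; lia.
have peS : p h < p e.+1 by have [] := ev e.+1; lia.
have desE : (e \in Des (row_word (relabel (cyc h e.+1) V))) = P e && (p h < p e).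
  rewrite Des_relabel // eSP /=; case: (cycP e.+1 h e.+1); try lia.
  by case: (cycP e.+1 h e) => *; try lia.
have tgtE : (e \in tgt) = P e && (p e.+1 < p e).
  by rewrite tgt_other ?eSP //; lia.
(* Now [e.+1] is read at [p h], and [p h < p e.+1]; a disagreement forces [p e] strictly between the
   two, so [e] is in A and B is empty. *)
have [eP' phe pee] : [/\ P e, p h < p e & p e < p e.+1].
  move: neq_e; rewrite desE tgtE; case: (boolP (P e)) => //= Pe ne.
  by have := p_neq Pe eSP (ltac:(lia) : e != e.+1); split=> //; lia.
have De' : descending e.
  split=> //; first lia.
  - by move=> v vI; have [->//|ve] := eqVneq v e; apply: ev; lia.
  - by move=> v vI vh; have [->//|ve] := eqVneq v e; apply: inc; lia.
have [e' [eP'' ev'' lp des]] := IHe De'; exists e'; split=> //.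
apply: (loop_swap (z := e)); last by rewrite swap_down //; lia.
apply: pivot_A => i.
  rewrite mem_setA // [RHS]inE; have [->|ie] := eqVneq i e.
    by rewrite desE -/tgt tgtE eP' phe /= -leqNgt ltnW.
  by rewrite agree ?andbN ?(negPf ie) //; lia.
rewrite mem_setB //; have [->|ie] := eqVneq i e; first by rewrite desE eP' phe.
by rewrite agree ?andNb //; lia.
Qed.

Lemma loop_ascending e : ascending e ->
  exists e', loop_result (relabel (cyc h e) V) e'.
Proof.
(* The largest letter bounds the ascent; the induction is on [M - e]. *)
have [M PM] : exists M, forall v, P v -> v <= M.
  by exists (\max_(v <- row_word V) v) => v Pv; apply: leq_bigmax_seq.
have [n] := ubnP (M - e); elim: n e => // n IHn e len De.
have eP := ascending_P De; have mem := relabel_mem eP.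
have agree := ascending_Des De; have ev' := ascending_lt De.
have [he ev dec hS] := De.
have [agree_e|neq_e] := eqVneq (e \in Des (row_word (relabel (cyc h e) V))) (e \in tgt).
  by exists e; apply: loop_stop eP ev' _ => i; have [->//|ie] := eqVneq i e;
    apply: agree.
have Pe : P e by apply: eP; rewrite /between; lia.
have phe : p h < p e by apply: ev'; rewrite /between; lia.
have desE : (e \in Des (row_word (relabel (cyc h e) V))) = P e.+1 && (p e.+1 < p h).
  rewrite Des_relabel // Pe /=; case: (cycP e h e) => [_|?|?|?]; try lia.
  by case: cycP => *; try lia.
have tgtE : (e \in tgt) = P e.+1 && (p e.+1 < p e).
  by rewrite tgt_other ?Pe //; lia.
(* Now [e] is read at [p h], and [p h < p e]; a disagreement forces [p e.+1] strictly between the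
   two, so [e] is in B and A is empty. *)
have [PeS pheS pee] : [/\ P e.+1, p h < p e.+1 & p e.+1 < p e].
  move: neq_e; rewrite desE tgtE; case: (boolP (P e.+1)) => //= PeS ne.
  by have := p_neq hP PeS (ltac:(lia) : h != e.+1); split=> //; lia.
have De' : ascending e.+1.
  split=> //; first lia.
  - by move=> v vI; have [->//|ve] := eqVneq v e.+1; apply: ev; lia.
  - by move=> v vI; have [->//|ve] := eqVneq v e; apply: dec; lia.
have le_M := PM _ PeS.
have [|e' [eP'' ev'' lp des]] := IHn e.+1 _ De'; first lia.
exists e'; split=> //; apply: (loop_swap (z := e)); last by rewrite swap_up //; lia.
apply: pivot_B => i.
  rewrite mem_setA //; have [->|ie] := eqVneq i e.
    by rewrite desE PeS ltnNge ltnW.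
  by rewrite agree ?andbN.
rewrite mem_setB // [RHS]inE; have [->|ie] := eqVneq i e.
  by rewrite desE -/tgt tgtE PeS pee /= -leqNgt ltnW.
by rewrite agree ?andNb ?(negPf ie).
Qed.

(** At the start only the predecessor of [h] can be in A and only [h] in B. The first swap, if any,
    fixes a direction and provides the last clause of [descending] or [ascending]. *)
Lemma loop_relabel : exists e, loop_result V e.
Proof.
have Ph v : between h v -> P v.
  by rewrite /between => vI; have -> : v = h by lia.
have idV : relabel (cyc h h) V = V.
  by apply: relabel_id => v; case: cycP; lia.
have agree i : i != h -> i.+1 != h -> (i \in Des (row_word V)) = (i \in tgt).
  by move=> ih iSh; rewrite tgt_other.
pose A := [&& 0 < h, P h.-1 & p h < p h.-1].
pose B := P h.+1 && (p h < p h.+1).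
have memA i : (i \in setA T V) = (i.+1 == h) && A.
  rewrite mem_setA //; have [iSh|iSh] := eqVneq i.+1 h; last first.
    have [->|ih] := eqVneq i h; last by rewrite agree // andbN.
    apply/negP => /andP[/Des_mem/andP[_ /tgt_h ht]]; by rewrite -/tgt ht.
  by rewrite tgt_pred // andbT /A -iSh /= !inE -/(P _) -/(P _) iSh hP -!/(p _).
have memB i : (i \in setB T V) = (i == h) && B.
  rewrite mem_setB //; have [->|ih] := eqVneq i h; last first.
    have [iSh|iSh] := eqVneq i.+1 h; last by rewrite agree // andNb.
    by rewrite (negPf (tgt_pred iSh)) andbF.
  rewrite /B; case: (boolP (P h.+1)) => hSP /=; last first.
    by apply/negP => /andP[_ /Des_mem/andP[_]]; rewrite -VT; apply/negP.
  rewrite -/tgt tgt_h // andbT !inE -/(P _) -/(P _) hP hSP /= -!/(p _) -leqNgt.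
  by have := p_neq hP hSP (ltac:(lia) : h != h.+1); lia.
have step z V' : pivot T V z -> swap z V = V' ->
    (exists e, loop_result V' e) -> exists e, loop_result V e.
  move=> pz <- [e [eP ev lp des]]; exists e; split=> //; exact: loop_swap pz lp.
have swapA a : a.+1 = h -> swap a V = relabel (cyc h a) V.
  move=> ah; have ahV : relabel (cyc h a.+1) V = V by rewrite ah.
  by rewrite -{1}ahV swap_down // -ah.
have swapB : swap h V = relabel (cyc h h.+1) V.
  by rewrite -[in LHS]idV swap_up.
have desc a : a.+1 = h -> A -> (P h.+1 -> p h.+1 < p a) -> descending a.
  move=> ah /and3P[h0 Pa pa] hS; split; first lia.
  - by move=> v vI; have -> : v = h.-1 by lia.
  - by move=> v *; lia.
  - by rewrite -ah in hS *.
have asc : B -> (forall a, a.+1 = h -> P a -> p a < p h.+1) -> ascending h.+1.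
  move=> /andP[PhS phS] hS; split=> //.
  - by move=> v vI; have -> : v = h.+1 by lia.
  - by move=> v vI; lia.
case: (boolP A) => hA; case: (boolP B) => hB.
- have [a ah] : exists a, a.+1 = h by exists h.-1; case/and3P: hA; lia.
  have setA1 : setA T V =i pred1 a.
    by move=> i; rewrite memA hA andbT -ah eqSS.
  have setB1 : setB T V =i pred1 a.+1 by move=> i; rewrite memB hB andbT ah.
  have aP : P a by case/and3P: hA => _; rewrite -ah.
  have hSP : P h.+1 by case/andP: hB.
  (* With two discrepancies Step 3 compares the positions of [a] and [h.+1]; either outcome is
     exactly the last clause needed for the direction it selects. *)
  have rp : (row_of V a < row_of V a.+2) = (p h.+1 < p a).
    by rewrite row_of_p ?ah.
  case: ltnP (rp) => lt /esym lt'.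
    apply: step (pivot_below setA1 setB1 lt) (swapA _ ah) _.
    by apply: loop_descending; apply: desc.
  apply: step (pivot_above setA1 setB1 lt) _ _; first by rewrite ah; apply: swapB.
  apply: loop_ascending; apply: asc => // b bh _; have -> : b = a by lia.
  by have := p_neq aP hSP (ltac:(lia) : a != h.+1); lia.
- have [a ah] : exists a, a.+1 = h by exists h.-1; case/and3P: hA; lia.
  apply: step (swapA _ ah) _; last first.
    apply: loop_descending; apply: desc => // hSP.
    case/and3P: hA => _ _; rewrite -[in h.-1]ah /= => pa.
    move: hB; rewrite /B hSP /= -leqNgt => le; exact: leq_ltn_trans pa.
  apply: pivot_A => i; first by rewrite memA hA andbT -ah eqSS.
  by rewrite memB (negPf hB) andbF.
- apply: step swapB _; last first.
    apply: loop_ascending; apply: asc => // a ah aP; case/andP: hB => _; apply: leq_ltn_trans.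
    by move: hA; rewrite /A -[in h.-1]ah aP /=; lia.
  apply: pivot_B => i; first by rewrite memA (negPf hA) andbF.
  by rewrite memB hB andbT.
exists h; rewrite -[V in loop_result V]idV; apply: loop_stop => //.
  by move=> v vh; rewrite /between; lia.
move=> i; rewrite idV; have := memA i; have := memB i.
rewrite (negPf hA) (negPf hB) !andbF mem_setA // mem_setB // -/tgt.
by do 2!case: (i \in _).
Qed.

End Loop.

(** * Restrictions *)

Section FirstColumns.

Implicit Types (alpha : seq nat).

Lemma boxes_first_columns alpha :
  [seq b <- boxes alpha | b.1 < 2] = boxes [seq minn a 2 | a <- alpha].
Proof.
apply: eq_boxes.
  by apply: sorted_filter; [exact: col_lt_trans | exact: boxes_sorted].
move=> b; rewrite mem_filter !mem_boxes; case: (ltnP b.2 (size alpha)) => bs.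
  by rewrite (nth_map 0) // leq_min andbC.
by rewrite !nth_default ?size_map // !ltn0 andbF.
Qed.

Lemma count_first_columns alpha :
  count (fun b : box => b.1 < 2) (boxes alpha) = col12 alpha.
Proof.
rewrite -size_filter boxes_first_columns size_boxes /col12 /col_size.
by elim: alpha => //= a alpha ->; lia.
Qed.

(** Lying in the first two columns is downward closed for [col_lt], so these boxes form a prefix of
    the list. *)
Lemma take_col12 alpha :
  take (col12 alpha) (boxes alpha) = [seq b <- boxes alpha | b.1 < 2].
Proof.
rewrite (filter_sorted_down col_lt_trans _ (boxes_sorted alpha)) ?count_first_columns //.
by move=> x y; rewrite /col_lt; lia.
Qed.

Lemma mem_take_col12 alpha j b : col12 alpha <= j ->
  b \in boxes alpha -> b.1 < 2 -> b \in take j (boxes alpha).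
Proof.
move=> jc bB b2; have : b \in take (col12 alpha) (boxes alpha).
  by rewrite take_col12 mem_filter b2.
by rewrite -(take_takel _ jc); apply: mem_take.
Qed.

Lemma col12_le alpha : col12 alpha <= sumn alpha.
Proof.
by rewrite -count_first_columns -size_boxes count_size.
Qed.

End FirstColumns.

Section Restrict.

Implicit Types (alpha : seq nat) (T : filling).

Lemma boxes_row alpha y :
  [seq b <- boxes alpha | b.2 == y] = [seq (x, y) | x <- iota 0 (nth 0 alpha y)].
Proof.
apply: (irr_sorted_eq col_lt_trans col_lt_irr).
- by apply: sorted_filter; [exact: col_lt_trans | exact: boxes_sorted].
- rewrite sorted_map; apply: sub_sorted (iota_ltn_sorted 0 _) => x x'.
  by rewrite /col_lt /= => ->.
move=> [x y']; rewrite mem_filter mem_boxes /=; apply/andP/mapP => [[/eqP-> xy]|].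
  by exists x; rewrite ?mem_iota.
by case=> x'; rewrite mem_iota => ? [-> ->].
Qed.

Definition row_count j alpha y : nat := count (fun b => b.2 == y) (take j (boxes alpha)).

(** Within a row the column order goes from left to right, so a prefix of the list meets each row in
    a left-justified segment. *)
Lemma take_boxes_row j alpha y :
  [seq b <- take j (boxes alpha) | b.2 == y]
  = [seq (x, y) | x <- iota 0 (row_count j alpha y)].
Proof.
rewrite filter_take -/(row_count j alpha y) boxes_row -map_take take_iota.
suff le : row_count j alpha y <= nth 0 alpha y by move/minn_idPl: le => ->.
rewrite -[nth 0 alpha y](size_iota 0) -(size_map (fun x => (x, y))) -boxes_row size_filter.
by rewrite /row_count -[in leqRHS](cat_take_drop j (boxes alpha)) count_cat leq_addr.
Qed.

Lemma mem_take_boxes j alpha b :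
  (b \in take j (boxes alpha)) = (b.1 < row_count j alpha b.2).
Proof.
case: b => x y /=; transitivity ((x, y) \in [seq b <- take j (boxes alpha) | b.2 == y]).
  by rewrite mem_filter /= eqxx.
rewrite take_boxes_row; apply/mapP/idP => [[x']|xy].
  by rewrite mem_iota => ? [->].
by exists x; rewrite ?mem_iota.
Qed.

Variables (T : filling) (j : nat).
Let alpha := shape T.
Let B := boxes alpha.
Hypothesis pk : is_peak_composition alpha.
Hypothesis jc : col12 alpha <= j.

Lemma row_count_gt0 y : y < size T -> 0 < row_count j alpha y.
Proof.
move=> yT; rewrite -[0]/((0, y).1) -[y in row_count _ _ y]/((0, y).2).
rewrite -mem_take_boxes mem_take_col12 //.
by have [] := peak_boxes pk yT.
Qed.

Lemma row_count_le y : row_count j alpha y <= size (nth [::] T y).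
Proof.
case E : (row_count j alpha y) => [//|m].
have : (m, y) \in take j B by rewrite mem_take_boxes /= E.
by move/mem_take; rewrite mem_shape_boxes.
Qed.

(** As [j] covers the first two columns, every row keeps its first box, and the removal of empty
    rows in [restrict] has no effect. *)
Lemma restrict_rows :
  restrict j T = mkseq (fun y => take (row_count j alpha y) (nth [::] T y)) (size T).
Proof.
have E : [seq [seq entry T b | b <- take j B & b.2 == y] | y <- iota 0 (size T)]
    = mkseq (fun y => take (row_count j alpha y) (nth [::] T y)) (size T).
  apply: eq_map => y; rewrite take_boxes_row -map_comp /comp /entry /=.
  by rewrite map_nth_iota0 // row_count_le.
rewrite /restrict E; apply/all_filterP/(all_nthP [::]) => y.
rewrite size_mkseq => yT; rewrite nth_mkseq // -size_eq0 size_takel ?row_count_le //.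
by rewrite -lt0n row_count_gt0.
Qed.

Lemma size_restrict : size (restrict j T) = size T.
Proof. by rewrite restrict_rows size_mkseq. Qed.

Lemma boxes_restrict : boxes (shape (restrict j T)) = take j B.
Proof.
apply/esym/eq_boxes; first exact/take_sorted/boxes_sorted.
move=> b; rewrite mem_shape_boxes restrict_rows mem_take_boxes.
case: (ltnP b.2 (size T)) => bT; first by rewrite nth_mkseq // size_takel ?row_count_le.
rewrite !nth_default ?size_mkseq //.
apply/negP => lt; have := leq_trans lt (row_count_le _).
by rewrite nth_default.
Qed.

Lemma entry_restrict b : b \in take j B -> entry (restrict j T) b = entry T b.
Proof.
move=> bj; have bT : b.2 < size T := box_row_lt (mem_take bj).
rewrite restrict_rows /entry nth_mkseq // nth_take //.
by rewrite -mem_take_boxes.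
Qed.

Lemma col_word_restrict : col_word (restrict j T) = [seq entry T b | b <- take j B].
Proof. by rewrite /col_word boxes_restrict; apply/eq_in_map => b /entry_restrict. Qed.

Lemma num_boxes_restrict : j <= sumn alpha -> num_boxes (restrict j T) = j.
Proof. by move=> jn; rewrite /num_boxes -size_boxes boxes_restrict size_takel ?size_boxes. Qed.

Lemma restrict_restrict i : i <= j -> restrict i (restrict j T) = restrict i T.
Proof.
move=> ij; rewrite /restrict -/(restrict j T) size_restrict boxes_restrict; congr filter.
apply: eq_map => y; rewrite take_takel //; apply/eq_in_map => b.
rewrite mem_filter => /andP[_ bi]; apply: entry_restrict.
by move: bi; rewrite -(take_takel _ ij); apply: mem_take.
Qed.

Lemma peak_restrict : is_peak_composition (shape (restrict j T)).
Proof.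
apply/peak_compositionP => y; rewrite size_map size_restrict => yT.
rewrite nth_shape restrict_rows nth_mkseq // size_takel ?row_count_le //.
case: (ltnP y.+1) => ySj /=; last exact: row_count_gt0.
have -> : (1 < row_count j alpha y) = ((1, y) \in take j B) by rewrite mem_take_boxes.
by apply: mem_take_col12 => //; apply: (peak_boxes pk yT).2.
Qed.

Lemma sorted_restrict : all (sorted ltn) T -> all (sorted ltn) (restrict j T).
Proof.
move=> /(all_nthP [::]) srt; rewrite restrict_rows; apply/(all_nthP [::]) => y.
by rewrite size_mkseq => yT; rewrite nth_mkseq // take_sorted ?srt.
Qed.

Lemma chain_restrict : chain T -> chain (restrict j T).
Proof.
move=> ch y; rewrite size_restrict => yT.
have [y0 _] := peak_boxes pk yT; have [_ y1] := peak_boxes pk (ltnW yT).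
by rewrite !entry_restrict; [exact: ch | |]; apply: mem_take_col12 => //; apply: y1.
Qed.

Lemma uniq_restrict : uniq (entries T) -> uniq (entries (restrict j T)).
Proof.
rewrite -(perm_uniq (perm_col_word T)) -(perm_uniq (perm_col_word (restrict j T))).
by rewrite col_word_restrict map_take; apply: take_uniq.
Qed.

Lemma mem_restrict v : v \in entries (restrict j T) -> v \in entries T.
Proof. by rewrite -!mem_col_word col_word_restrict map_take; apply: mem_take. Qed.

End Restrict.

Lemma restrict_all T : is_peak_composition (shape T) -> restrict (sumn (shape T)) T = T.
Proof.
move=> pk; have jc := col12_le (shape T); rewrite restrict_rows //.
apply: (@eq_from_nth _ [::]); rewrite size_mkseq // => y yT; rewrite nth_mkseq //.
rewrite take_oversize // /row_count -size_boxes take_size -size_filter boxes_row.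
by rewrite size_map size_iota nth_shape.
Qed.

(** * The stages *)

Lemma row_of_entry V b : uniq (entries V) -> b \in boxes (shape V) ->
  row_of V (entry V b) = b.2.
Proof.
move=> uV bV; have := bV; rewrite mem_shape_boxes => b1.
have b2 := box_row_lt bV.
have hasV : has (fun r : seq nat => entry V b \in r) V.
  by apply/hasP; exists (nth [::] V b.2); rewrite ?mem_nth.
have /(nthP 0)[x xlt xb] := nth_find [::] hasV.
have xV : (x, row_of V (entry V b)) \in boxes (shape V) by rewrite mem_shape_boxes.
by have /(congr1 snd) := entry_inj uV xV bV xb.
Qed.

(** The sizes are compared separately because a trailing part 0 contributes no box. *)
Lemma boxes_inj (alpha beta : seq nat) :
  size alpha = size beta -> boxes alpha =i boxes beta -> alpha = beta.
Proof.
move=> sz eqb; apply: (@eq_from_nth _ 0) => // y _.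
have lt x : (x < nth 0 alpha y) = (x < nth 0 beta y).
  by have := eqb (x, y); rewrite !mem_boxes.
(* Taking [x] to be each of the two row lengths gives both inequalities. *)
apply/eqP; rewrite eqn_leq; move: (lt (nth 0 alpha y)) (lt (nth 0 beta y)); rewrite !ltnn.
by move=> ? ?; apply/andP; lia.
Qed.

Section Stage.

(** In the application [T] is a truncation of the given tableau, [U] the result of the previous
    stage and [q] the last box of [T] in column order. Columns count from 0, so [1 < q.1] means the
    third column or later. *)
Variables (T U : filling) (q : box).
Hypothesis boxesT : boxes (shape T) = rcons (boxes (shape U)) q.
Hypothesis sizeT : size T = size U.
Hypothesis q2 : 1 < q.1.
Hypothesis uT : uniq (entries T).
Let h := entry T q.
Let w := [seq entry T b | b <- boxes (shape U)].
Hypothesis permU : perm_eq (entries U) w.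
Hypothesis desU : Des (row_word U) =i Des w.
Hypothesis pkU : is_peak_composition (shape U).
Hypothesis srtU : all (sorted ltn) U.
Hypothesis chU : chain U.
Hypothesis left_lt : entry U (q.1.-1, q.2) < h.

Let V := add_box U q h.

Lemma col_word_rcons : col_word T = rcons w h.
Proof. by rewrite /col_word boxesT map_rcons. Qed.

Lemma uniq_rcons_w : uniq (rcons w h).
Proof. by rewrite -col_word_rcons (perm_uniq (perm_col_word T)). Qed.

Lemma uniqU : uniq (entries U).
Proof. by rewrite (perm_uniq permU); have := uniq_rcons_w; rewrite rcons_uniq => /andP[]. Qed.

Lemma qT : q \in boxes (shape T).
Proof. by rewrite boxesT mem_rcons mem_head. Qed.

Lemma q_notin : q \notin boxes (shape U).
Proof. by have := boxes_uniq (shape T); rewrite boxesT rcons_uniq => /andP[]. Qed.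

Lemma mem_boxesT b : (b \in boxes (shape T)) = (b == q) || (b \in boxes (shape U)).
Proof. by rewrite boxesT mem_rcons inE. Qed.

Lemma left_in x : x < q.1 -> (x, q.2) \in boxes (shape U).
Proof.
move=> xq; have := mem_boxesT (x, q.2); rewrite -[_ == q]/((x == q.1) && (q.2 == q.2)).
have -> : (x, q.2) \in boxes (shape T).
  by rewrite mem_boxes /=; apply: ltn_trans xq _; rewrite -mem_boxes qT.
by rewrite (ltn_eqF xq).
Qed.

(** The left neighbour of [q] is in [U] and [q] is not, so [q] is appended at the end of its row. *)
Lemma size_row : size (nth [::] U q.2) = q.1.
Proof.
have := q_notin; have := @left_in q.1.-1; rewrite !mem_shape_boxes /=; lia.
Qed.

Lemma q2_lt : q.2 < size U.
Proof. by rewrite -sizeT; apply: box_row_lt qT. Qed.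

Lemma nth_add_box y :
  nth [::] V y = if y == q.2 then rcons (nth [::] U q.2) h else nth [::] U y.
Proof.
rewrite /V /add_box nth_set_nth /=; case: eqP => // _.
by rewrite set_nthE -size_row ltnn subnn cats1.
Qed.

Lemma size_add_box : size V = size U.
Proof. by rewrite size_set_nth; have := q2_lt; lia. Qed.

Lemma boxes_add_box : boxes (shape V) = boxes (shape T).
Proof.
apply: eq_boxes; first exact: boxes_sorted.
move=> b; rewrite mem_boxesT !mem_shape_boxes nth_add_box.
case: b => x y /=; rewrite -[_ == q]/((x == q.1) && (y == q.2)).
case: eqP => [->|_]; rewrite ?andbF // size_rcons size_row; lia.
Qed.

Lemma shape_add_box : shape V = shape T.
Proof.
apply: boxes_inj; first by rewrite !size_map size_add_box sizeT.
by move=> b; rewrite boxes_add_box.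
Qed.

Lemma entry_add_box_new : entry V q = h.
Proof. by rewrite /entry nth_add_box eqxx nth_rcons size_row ltnn eqxx. Qed.

Lemma entry_add_box b : b \in boxes (shape U) -> entry V b = entry U b.
Proof.
rewrite mem_shape_boxes /entry nth_add_box => bU; case: eqP => // e.
by rewrite nth_rcons -e bU.
Qed.

Lemma col_word_add_box : col_word V = rcons (col_word U) h.
Proof.
rewrite /col_word boxes_add_box boxesT map_rcons entry_add_box_new; congr rcons.
by apply/eq_in_map => b; apply: entry_add_box.
Qed.

Lemma perm_add_box : perm_eq (entries V) (entries T).
Proof.
rewrite -(permPl (perm_col_word V)) -(permPr (perm_col_word T)).
rewrite col_word_add_box col_word_rcons -!cats1 perm_cat2r.
by rewrite (permPl (perm_col_word U)).
Qed.

Lemma uniqV : uniq (entries V).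
Proof. by rewrite (perm_uniq perm_add_box). Qed.

Lemma mem_entriesV v : (v \in entries V) = (v == h) || (v \in entries U).
Proof. by rewrite -mem_col_word col_word_add_box mem_rcons inE mem_col_word. Qed.

Lemma h_notin : h \notin entries U.
Proof. by rewrite (perm_mem permU); have := uniq_rcons_w; rewrite rcons_uniq => /andP[]. Qed.

Let p v := index v (row_word V).

Lemma p_entry b c : b \in boxes (shape U) -> c \in boxes (shape U) ->
  (p (entry U b) < p (entry U c)) = row_lt b c.
Proof.
move=> bU cU; rewrite -!entry_add_box // /p index_row_word ?uniqV //.
- by rewrite boxes_add_box mem_boxesT bU orbT.
- by rewrite boxes_add_box mem_boxesT cU orbT.
Qed.

Lemma p_new b : b \in boxes (shape U) -> (p h < p (entry U b)) = row_lt q b.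
Proof.
move=> bU; rewrite -entry_add_box // -entry_add_box_new /p index_row_word ?uniqV //.
- by rewrite boxes_add_box qT.
- by rewrite boxes_add_box mem_boxesT bU orbT.
Qed.

Lemma row_word_add_box : row_word V =i col_word T.
Proof. by move=> v; rewrite mem_row_word mem_col_word (perm_mem perm_add_box). Qed.

(** [h] ends the column word, so both of its neighbouring values, when present, are read before it.
    Elsewhere [desU] applies, because adding [q] keeps the relative positions of the old entries. *)
Lemma loop_add_box : exists e, loop_result T V h V e.
Proof.
have hw : h \notin w by rewrite -(perm_mem permU) h_notin.
have Pw i : i != h -> (i \in row_word V) = (i \in w).
  by move=> ih; rewrite mem_row_word mem_entriesV (negPf ih) (perm_mem permU).
apply: loop_relabel; first exact: row_word_add_box.
- by rewrite mem_row_word mem_entriesV eqxx.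
- rewrite col_word_rcons Pw ?(gtn_eqF (ltnSn h)) // => hSw.
  rewrite !inE !mem_rcons !inE eqxx hSw orbT /=.
  by rewrite index_rcons_last // index_rcons_in // index_mem.
- move=> a ah; rewrite col_word_rcons !inE !mem_rcons !inE ah eqxx /=.
  have ah' : (a == h) = false by rewrite -ah ltn_eqF.
  rewrite ah' /=; apply/negP => /andP[aw]; rewrite index_rcons_last // index_rcons_in //.
  by rewrite ltnNge index_size.
- move=> i ih iSh; have -> : (i \in Des (col_word T)) = (i \in Des w).
    rewrite col_word_rcons !inE !mem_rcons !inE (negPf ih) (negPf iSh) /=.
    by case: (boolP (i \in w)) => //= iw; case: (boolP (i.+1 \in w)) => //= iSw;
      rewrite !index_rcons_in.
  rewrite -desU !inE !mem_row_word !mem_entriesV (negPf ih) (negPf iSh) /=.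
  have [/entriesP[b bU ib]|//] := boolP (i \in entries U).
  have [/entriesP[c cU ic]|//] := boolP (i.+1 \in entries U).
  by rewrite /= ic ib index_row_word ?uniqU // -/(p _) -/(p _) p_entry.
- move=> a ah; rewrite !mem_row_word !mem_entriesV.
  have -> : (a == h) = false by apply/eqP; lia.
  have -> : (a.+2 == h) = false by apply/eqP; lia.
  move=> /= /entriesP[b bU ab] /entriesP[c cU ac].
  have bV : b \in boxes (shape V) by rewrite boxes_add_box mem_boxesT bU orbT.
  have cV : c \in boxes (shape V) by rewrite boxes_add_box mem_boxesT cU orbT.
  rewrite ac ab -/(p _) -/(p _) p_entry // -!entry_add_box // !row_of_entry ?uniqV //.
  (* If [a] and [a.+2] share a row, that row increases, [a] is read first, and both sides are
     false. *)
  rewrite /row_lt; case: ltnP => //= le; apply/esym/negP => /andP[/eqP e lt].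
  have := @entry_row_lt U c.1 b.1 b.2 srtU lt; rewrite -{2}e -!surjective_pairing.
  by move/(_ bU); lia.
Qed.

(** By [cyc_mono] the old entries keep their relative order, so the chain and the rows carry over
    from [U]; only the new entry at the end of its row needs an argument. *)
Lemma stage_step : exists e, let W := relabel (cyc h e) V in
  [/\ loop T V W, Des (row_word W) =i Des (col_word T), shape W = shape T,
      perm_eq (entries W) (entries T) & all (sorted ltn) W] /\
  [/\ chain W, forall v, between h e v -> v \in entries T, entry W q = e
    & forall b, b \in boxes (shape U) -> entry W b = cyc h e (entry U b)].
Proof.
have [e [eP ev lp des]] := loop_add_box; exists e => W.
have eT v : between h e v -> v \in entries T.
  by move/eP; rewrite row_word_add_box mem_col_word.
have entW b : b \in boxes (shape U) -> entry W b = cyc h e (entry U b).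
  move=> bU; rewrite entry_relabel ?entry_add_box //.
  by rewrite boxes_add_box mem_boxesT bU orbT.
have neq_h b : b \in boxes (shape U) -> entry U b != h.
  by move=> bU; apply: contra h_notin => /eqP <-; apply: mem_entry.
split; split=> //.
- by rewrite shape_relabel shape_add_box.
- rewrite -(permPr perm_add_box) entries_relabel.
  apply: uniq_perm; rewrite ?map_inj_uniq ?uniqV //; try exact: cyc_inj.
  move=> v; rewrite -[v in LHS](@cycK e h) mem_map; last exact: cyc_inj.
  apply: (mem_cyc (P := [in entries V])) => u ul; rewrite (perm_mem perm_add_box).
  by apply: eT; move: ul; rewrite /between; lia.
- rewrite all_map; apply/(all_nthP [::]) => y; rewrite size_add_box => yU /=.
  have srty := all_nthP [::] srtU y yU.
  have in_row v : v \in nth [::] U y -> v \in entries U.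
    by move=> vU; apply/flattenP; exists (nth [::] U y); rewrite ?mem_nth.
  have srt' : sorted ltn [seq cyc h e v | v <- nth [::] U y].
    apply: (homo_sorted_in (P := [in nth [::] U y])) srty; last by apply/allP.
    move=> v v' vU v'U /=; rewrite cyc_mono //.
    - by apply: contra h_notin => /eqP <-; apply: in_row.
    - by apply: contra h_notin => /eqP <-; apply: in_row.
  rewrite nth_add_box; case: eqP srt' => // -> srt'; rewrite map_rcons.
  have cyc_h : cyc h e h = e by rewrite /cyc eqxx.
  apply/(sortedP 0) => i; rewrite size_rcons size_map size_row ltnS => iq.
  rewrite !nth_rcons size_map size_row iq.
  have [iSq|] := ltnP i.+1 q.1.
    by move/(sortedP 0): srt'; apply; rewrite size_map size_row.
  move=> qi; have -> : i.+1 = q.1 by lia.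
  rewrite eqxx cyc_h (nth_map 0) ?size_row //.
  have iE : i = q.1.-1 by lia.
  have iU : (i, q.2) \in boxes (shape U) by apply: left_in.
  rewrite -[nth 0 _ i]/(entry U (i, q.2)); have := left_lt; rewrite -iE => lt_h.
  (* The values met are read after [h], the left neighbour before it. So its entry is outside the
     interval and below [h], hence below [e] and fixed by [cyc]. *)
  have out : ~~ between h e (entry U (i, q.2)).
    apply/negP => /(ev _ (neq_h _ iU)); rewrite -/(p _) -/(p _) p_new // /row_lt /=; lia.
  by move: out; rewrite /between; case: cycP; lia.
- move=> y; rewrite size_map size_add_box => yU.
  have [y0 _] := peak_boxes pkU yU; have [_ /(_ yU) y1] := peak_boxes pkU (ltnW yU).
  by rewrite !entW // cyc_mono ?neq_h // chU.
- by rewrite entry_relabel ?entry_add_box_new ?/cyc ?eqxx // boxes_add_box qT.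
Qed.

End Stage.

(** * Uniqueness of the run *)

Section Determinism.

Variable T : filling.

Lemma pivot_det V z z' : pivot T V z -> pivot T V z' -> z = z'.
Proof.
have eq1 a a' (p : pred nat) : p =i pred1 a -> p =i pred1 a' -> a = a'.
  by move=> pa pa'; apply/eqP; rewrite -[_ == _]/(a \in pred1 a') -pa' pa inE.
have ne1 a (p : pred nat) : p =i pred1 a -> p =i pred0 -> False.
  by move=> pa p0; have := pa a; rewrite p0 !inE eqxx.
case=> [a A B lt|a A B ge|a A B|b A B]; case=> [a' A' B' lt'|a' A' B' ge'|a' A' B'|b' A' B'];
  by [exact: eq1 A A' | exact: eq1 B B' | case: (ne1 _ _ A A') | case: (ne1 _ _ A' A)
     | case: (ne1 _ _ B B') | case: (ne1 _ _ B' B)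
     | have aa' := eq1 _ _ _ A A'; subst a'; lia].
Qed.

Lemma pivot_neq0 V z : pivot T V z -> setA T V =i pred0 -> setB T V =i pred0 -> False.
Proof.
by case=> [a A B _|a A B _|a A B|b A B] A0 B0;
  [have := A a|have := A a|have := A a|have := B b]; rewrite ?A0 ?B0 !inE eqxx.
Qed.

Lemma loop_det V W W' : loop T V W -> loop T V W' -> W = W'.
Proof.
move=> lW; elim: lW W' => {V W} [V A B|V z W pz lW IH] W' lW'.
  by case: lW' A B => // V' z W'' pz _ A B; case: (pivot_neq0 pz A B).
case: lW' pz IH => [V' A B pz _|V' z' W'' pz' lW' pz IH]; first by case: (pivot_neq0 pz A B).
by apply: IH; rewrite (pivot_det pz pz').
Qed.

End Determinism.

(** Consecutive entries in different rows must be a second-column entry followed by the start of a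
    higher row, which is a descent in both readings. Within a row the two readings agree. *)
Lemma Des_two_columns V : is_peak_composition (shape V) -> uniq (entries V) ->
    all (sorted ltn) V -> chain V -> {in boxes (shape V), forall b, b.1 < 2} ->
  Des (row_word V) =i Des (col_word V).
Proof.
move=> pk uV srt ch two i; rewrite !inE !mem_row_word !mem_col_word.
have [/entriesP[b bV ib]|//] := boolP (i \in entries V).
have [/entriesP[c cV ic]|//] := boolP (i.+1 \in entries V).
rewrite /= ic ib index_row_word // index_col_word //.
have bc : entry V c = (entry V b).+1 by rewrite -ic ib.
have rowV := @box_row_lt V.
have lt3 m n k l : m < n -> n < k -> k < l -> m.+2 < l by lia.
(* The two added terms account for the second entry of the row of [d] and the first entry of the row
   of [d'], when these lie strictly between. *)
have lt_rows d d' : d \in boxes (shape V) -> d' \in boxes (shape V) -> d.2 < d'.2 ->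
    entry V d + (d.1 == 0) + d'.1 < entry V d'.
  move=> dV d'V lt.
  have := chain_lt pk srt ch (y := d.2) (y' := d'.2); rewrite lt (rowV _ d'V) => /(_ isT).
  have [_ y1] := peak_boxes pk (rowV _ dV).
  have := entry_row_lt srt (ltnSn 0) (y1 (leq_ltn_trans lt (rowV _ d'V))).
  have := two _ dV; have := two _ d'V.
  case: d d' dV d'V lt {y1} => [x y] [x' y'] /= dV d'V lt.
  case: x x' dV d'V => [|[|//]] [|[|//]] dV d'V _ _ /=; rewrite ?addn0 ?addn1; try lia.
  - by move=> lt1 lt2; have := entry_row_lt srt (ltnSn 0) d'V; apply: lt3 lt1 lt2.
  - by move=> _; have := entry_row_lt srt (ltnSn 0) d'V => lt2 lt1; apply: leq_ltn_trans lt1 lt2.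
have := lt_rows b c bV cV; have := lt_rows c b cV bV; move: (two _ bV) (two _ cV) bc.
case: b c bV cV {ib ic} => [x y] [x' y'] bV cV; rewrite /row_lt /col_lt /= => x2 x'2 bc lt1 lt2.
case: (ltngtP y y') => [lt|lt|eqy] /=; rewrite ?eqy /=.
- by have := lt2 lt; lia.
- by have := lt1 lt; lia.
- by case: (ltngtP x x').
Qed.

(** * Induction over the stages and the resulting map *)

Section Xi.

Variables (alpha : seq nat) (T : filling).
Hypothesis pk : is_peak_composition alpha.
Hypothesis spitT : is_SPIT alpha T.

Let B := boxes alpha.
Let c := col12 alpha.
Let S j := restrict j T.

(** In the last clause [f] is an entry still to be added; at the next stage this clause supplies
    [left_lt]. *)
Definition stage_inv j U : Prop :=
  [/\ shape U = shape (S j), perm_eq (entries U) (entries (S j)),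
      all (sorted ltn) U, chain U & Des (row_word U) =i Des (col_word (S j))] /\
  forall b f, b \in take j B -> f \in entries T -> f \notin entries U ->
    entry T b < f -> entry U b < f.

Lemma SPIT_facts : [/\ shape T = alpha, perm_eq (entries T) (iota 1 (sumn alpha)),
  all (sorted ltn) T & chain T].
Proof. exact/is_SPITP. Qed.

Lemma stage_inv0 : stage_inv c (S c).
Proof.
have [shT pT srt ch] := SPIT_facts.
have pkT : is_peak_composition (shape T) by rewrite shT.
have jc : col12 (shape T) <= c by rewrite shT.
split; last by move=> b f bc _ _; rewrite entry_restrict // shT.
split=> //; [exact: sorted_restrict | exact: chain_restrict |].
apply: Des_two_columns; [exact: peak_restrict | | exact: sorted_restrict | exact: chain_restrict|].
  by apply: uniq_restrict => //; rewrite (perm_uniq pT) iota_uniq.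
by move=> b; rewrite boxes_restrict // shT take_col12 mem_filter => /andP[].
Qed.

Lemma stage_invS j U : c <= j < sumn alpha -> stage_inv j U ->
  exists W, [/\ algorithm_returns (S j.+1) U W,
    forall W', algorithm_returns (S j.+1) U W' -> W' = W & stage_inv j.+1 W].
Proof.
move=> /andP[cj jn] [[shU pU srtU chU desU] before].
have [shT pT srt ch] := SPIT_facts.
have uT : uniq (entries T) by rewrite (perm_uniq pT) iota_uniq.
have pkT : is_peak_composition (shape T) by rewrite shT.
have jc : col12 (shape T) <= j by rewrite shT.
have jSc : col12 (shape T) <= j.+1 by rewrite leqW.
have jB : j < size B by rewrite size_boxes.
pose q := nth (0, 0) B j.
have takeS : take j.+1 B = rcons (take j B) q by rewrite (take_nth (0, 0)).
have boxesS : boxes (shape (S j.+1)) = rcons (take j B) q.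
  by rewrite boxes_restrict // shT takeS.
have boxesU : boxes (shape U) = take j B by rewrite shU boxes_restrict // shT.
have qB : q \in B by rewrite mem_nth.
have qU : q \notin take j B.
  by have := take_uniq j.+1 (boxes_uniq alpha); rewrite takeS rcons_uniq => /andP[].
have q2 : 1 < q.1.
  by rewrite ltnNge; apply: contra qU => q1; apply: mem_take_col12.
have entryS b : b \in take j.+1 B -> entry (S j.+1) b = entry T b.
  by move=> bB; rewrite entry_restrict // shT.
have sub b : b \in take j B -> b \in take j.+1 B.
  by rewrite takeS mem_rcons inE orbC => ->.
have colSj : col_word (S j) = [seq entry (S j.+1) b | b <- boxes (shape U)].
  rewrite col_word_restrict // boxesU shT.
  by apply/esym/eq_in_map => b /sub /entryS.
have qS : q \in take j.+1 B by rewrite takeS mem_rcons mem_head.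
have mem_rest f : (f \in entries U) = (f \in [seq entry T b | b <- take j B]).
  by rewrite (perm_mem pU) -mem_col_word col_word_restrict // shT.
have hU : entry T q \notin entries U.
  rewrite mem_rest; apply/mapP => -[b bj /(entry_inj uT)].
  by rewrite shT => /(_ qB (mem_take bj)) qb; rewrite -qb (negPf qU) in bj.
have qT : q \in boxes (shape T) by rewrite shT.
(* The left neighbour of [q] is among the first [j] boxes and its entry in [T] is below that of [q]
   by row increase; [before] transfers this to [U]. *)
have left_lt : entry U (q.1.-1, q.2) < entry (S j.+1) q.
  have leftq : q.1.-1 < q.1 by lia.
  rewrite entryS //; apply: before hU _; rewrite ?mem_entry //.
    have : (q.1.-1, q.2) \in take j.+1 B.
      by rewrite mem_take_boxes /=; apply: ltn_trans leftq _; rewrite -mem_take_boxes.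
    rewrite takeS mem_rcons inE => /predU1P[e|//].
    by move: leftq; rewrite -[X in _ < X.1]e /= ltnn.
  by rewrite [X in _ < entry T X]surjective_pairing entry_row_lt // -surjective_pairing.
have sizeS : size (S j.+1) = size U.
  by rewrite -(size_map size U) -/(shape U) shU size_map !size_restrict.
have uS : uniq (entries (S j.+1)) by apply: uniq_restrict.
have pUw : perm_eq (entries U) [seq entry (S j.+1) b | b <- boxes (shape U)].
  by rewrite -colSj (permPl pU) perm_sym perm_col_word.
have desUw : Des (row_word U) =i Des [seq entry (S j.+1) b | b <- boxes (shape U)].
  by rewrite -colSj.
have pkU : is_peak_composition (shape U) by rewrite shU; apply: peak_restrict.
have [|e [[lp des shW pW srtW] [chW eP Wq WU]]] :=
  stage_step (T := S j.+1) _ sizeS q2 uS pUw desUw pkU srtU chU left_lt.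
  by rewrite boxesU.
set h := entry (S j.+1) q in lp des shW pW srtW chW eP Wq WU *.
set V := add_box U q h in lp des shW pW srtW chW eP Wq WU *.
set W := relabel (cyc h e) V in lp des shW pW srtW chW Wq WU *.
have posT : {in entries T, forall v, 0 < v}.
  by move=> v; rewrite (perm_mem pT) mem_iota => /andP[].
have memS v : v \in entries (S j.+1) -> v \in entries T by apply: mem_restrict.
have subU v : v \in entries U -> v \in entries (S j.+1).
  rewrite mem_rest -mem_col_word col_word_restrict // shT takeS map_rcons.
  by rewrite mem_rcons inE => ->; rewrite orbT.
have numU : num_boxes U = j.
  by rewrite /num_boxes shU -/(num_boxes (S j)) num_boxes_restrict // shT ltnW.
have restrictS : restrict (num_boxes U) (S j.+1) = S j.
  by rewrite numU restrict_restrict.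
have aligned : shape_descent_aligned (S j.+1) U.
  split; split.
  - apply: is_gen_SPIT_chain => //; first exact: peak_restrict; last 2 first.
    - exact: sorted_restrict.
    - exact: chain_restrict.
    by apply/allP => v /memS /posT.
  - apply: is_gen_SPIT_chain => //.
      by rewrite (perm_uniq pU) uniq_restrict.
    by apply/allP => v /subU /memS /posT.
  - by rewrite numU num_boxes_restrict // shT.
  (* The row of [q] has length at least 3, as [q] lies beyond the second column. *)
  - apply/(has_nthP 0); exists q.2; last first.
      by apply: leq_ltn_trans q2 _; rewrite -mem_boxes boxesS -takeS.
    by apply: (@nth0_size _ q.1); rewrite -mem_boxes boxesS -takeS.
  - by rewrite restrictS.
  - by rewrite restrictS; apply: perm_mem.
  - by rewrite restrictS.
exists W; split.
- split=> //; exists q => //.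
  by rewrite boxesS -takeS qS entryS.
- move=> W' [_ [b /andP[bS bU]]]; move: bS; rewrite boxesS mem_rcons inE.
  (* Any box other than [q] carries an entry of [U], so the algorithm must add [q]; the run is then
     unique. *)
  case/predU1P => [->|bj]; first by move/(loop_det lp).
  by move: bU; rewrite entryS ?sub // mem_rest map_f.
split; first by split.
move=> b f; rewrite takeS mem_rcons inE => bj fT fW bf.
have fS : f \notin entries (S j.+1) by rewrite -(perm_mem pW).
have eP' v : (e <= v <= h) || (h <= v <= e) -> v \in entries (S j.+1).
  by move=> vI; apply: eP; rewrite /between.
(* The new entry is [e], the image of [h] under [cyc], so [cyc_lt] applies to the new box as to the
   old ones: [f] is not yet present and cannot be crossed. *)
have [bq|bq] := eqVneq b q.
  have <- : cyc h e h = entry W b by rewrite bq Wq /cyc eqxx.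
  by apply: (cyc_lt (P := [in entries (S j.+1)])) => //; rewrite /h entryS // -bq.
move: bj; rewrite (negPf bq) /= => bj.
rewrite WU ?boxesU //; apply: (cyc_lt (P := [in entries (S j.+1)])) => //.
by apply: before => //; apply: contra fS; apply: subU.
Qed.

(** The equivalence with an equality carries existence and uniqueness through the induction
    together. *)
Lemma Xi_stageP i : i <= sumn alpha - c ->
  exists2 U, stage_inv (c + i) U & forall U', Xi_stage alpha T i U' <-> U' = U.
Proof.
elim: i => [|i IHi] ic.
  exists (S c); first by rewrite addn0; apply: stage_inv0.
  move=> U'; split=> [st|->]; last exact: Xi_stage0.
  by inversion st.
have [U invU stU] := IHi (ltnW ic).
have [|W [alg algU inv]] := stage_invS _ invU; first by lia.
exists W; first by rewrite addnS.
move=> W'; split=> [st|->].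
  inversion st as [|i' U' W'' st' alg']; subst.
  by apply: algU; rewrite -addnS; move/stU: st' alg' => ->.
apply: Xi_stageS (iffRL (stU U) erefl) _.
by rewrite addnS.
Qed.

Lemma Xi_yieldsP : exists V, [/\ is_SPIT alpha V,
  forall V', Xi_yields alpha T V' <-> V' = V & Des (col_word T) =i Des (row_word V)].
Proof.
have [V [[shV pV srtV chV desV] _] stV] := Xi_stageP (leqnn _).
have [shT pT _ _] := SPIT_facts.
have ST : S (c + (sumn alpha - c)) = T.
  rewrite subnKC; last exact: col12_le.
  by rewrite /S -shT restrict_all // shT.
rewrite ST in shV pV desV; exists V; split=> //.
by apply/is_SPITP => //; split=> //; [rewrite shV | apply: perm_trans pT].
Qed.

End Xi.

Theorem theorem3p8 (alpha : seq nat) (halpha : is_peak_composition alpha) :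
  exists Xi : SPIT alpha -> SPIT alpha,
    (forall (T : SPIT alpha) (V : filling),
        Xi_yields alpha (sval T) V <-> V = sval (Xi T)) /\
    (forall T : SPIT alpha,
        Des (col_word (sval T)) =i Des (row_word (sval (Xi T)))).
Proof.
(* The image is known only through a propositional existence; description extracts it, and the
   equivalence in [Xi_yieldsP] identifies it with the value constructed. *)
pose Xi_spec (T : SPIT alpha) :=
  constructive_indefinite_description _ (Xi_yieldsP halpha (svalP T)).
exists (fun T => let: exist V HV := Xi_spec T in let: And3 sV _ _ := HV in exist _ V sV).
by split=> T; case: (Xi_spec T) => V [].
Qed.
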